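(* Let $\mathcal N$ be a finite, locally irreducible, strongly connected and critical abelian network. Then for all but finitely many positive integers $m$, the action of the torsion group on the recurrent components of level $m$, $$\mathrm{Tor}(\mathcal N)\times\overline{\mathrm{Rec}}(\mathcal N,m)\to\overline{\mathrm{Rec}}(\mathcal N,m),$$ is (well defined and) free and transitive.
   Context: Abelian networks. $\mathbb N=\{0,1,2,\dots\}$. Let $G=(V,E)$ be a finite directed graph (self-loops and multiple edges allowed). An abelian network $\mathcal N$ on $G$ assigns to each $v\in V$ a nonempty input alphabet $A_v$ and a nonempty state space $Q_v$ (the $A_v$ pairwise disjoint), maps $T_a:Q_v\to Q_v$ for $a\in A_v$, and, for each edge $e$ from $v$ to $u$, a message-passing function $T_e:Q_v\times A_v\to A_u^*$ (free monoid of words), such that for all $v$, $a,b\in A_v$, $q\in Q_v$: $T_aT_b=T_bT_a$, and for every edge $e$ out of $v$ the words $T_e(q,a)T_e(T_a(q),b)$ and $T_e(q,b)T_e(T_b(q),a)$ agree up to permuting letters. Put $A=\bigsqcup_v A_v$, $Q=\prod_v Q_v$; $\mathcal N$ is finite if $A$ and $Q$ are finite. For a word $w\in A^*$, $|w|\in\mathbb N^A$ counts the occurrences of each letter. For $a\in A_v$, $\mathbf q\in Q$: $t_a\mathbf q$ is $\mathbf q$ with $\mathbf q(v)$ replaced by $T_a(\mathbf q(v))$, and $\mathbf M_a(\mathbf q)=\sum_{e\text{ out of }v}|T_e(\mathbf q(v),a)|\in\mathbb N^A$. A configuration is a pair $\mathbf x.\mathbf q$ with $\mathbf x\in\mathbb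 Z^A$, $\mathbf q\in Q$; $\pi_a(\mathbf x.\mathbf q)=(\mathbf x+\mathbf M_a(\mathbf q)-|a|).t_a\mathbf q$. For $w=a_1\cdots a_\ell$: $t_w=t_{a_\ell}\cdots t_{a_1}$, $\mathbf M_w(\mathbf q)=\sum_i\mathbf M_{a_i}(t_{a_1\cdots a_{i-1}}\mathbf q)$, $\pi_w=\pi_{a_\ell}\cdots\pi_{a_1}$; these depend only on $|w|$, so $t_{\mathbf n},\mathbf M_{\mathbf n},\pi_{\mathbf n}$ are defined for $\mathbf n\in\mathbb N^A$. The word $w$ is legal for $\mathbf x.\mathbf q$ if, with $\mathbf x_i.\mathbf q_i=\pi_{a_1\cdots a_i}(\mathbf x.\mathbf q)$, $\mathbf x_{i-1}(a_i)\ge1$ for all $1\le i\le\ell$. Write $\mathbf x.\mathbf q\xrightarrow{w}\mathbf x'.\mathbf q'$ if $w$ is legal for $\mathbf x.\mathbf q$ and $\pi_w(\mathbf x.\mathbf q)=\mathbf x'.\mathbf q'$; write $\mathbf x.\mathbf q\to\mathbf x'.\mathbf q'$ if this holds for some (possibly empty) $w$. Local recurrence, kernel, production matrix. $\mathcal N$ is locally irreducible if for all $\mathbf q,\mathbf q'\in Q$ there are words $w,w'$ with $t_w\mathbf q=t_{w'}\mathbf q'$. For $\mathcal N$ finite, let $e$ be the product of all idempotents of the finite commutative monoid generated by the $t_a$ in $\mathrm{End}(Q)$; $\mathrm{Loc}(\mathcal N)=eQ$ is the set of locally recurrent states. The total kernel is $K=\{\mathbf z\in\mathbb Z^A: t_{\mathbf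 z^+}\mathbf q=t_{\mathbf z^-}\mathbf q\ \forall\mathbf q\in\mathrm{Loc}(\mathcal N)\}$, with $\mathbf z^{\pm}\in\mathbb N^A$ the positive/negative parts of $\mathbf z$; it is a finite-index subgroup of $\mathbb Z^A$. For $\mathcal N$ finite and locally irreducible, the production matrix $P$ is the unique rational $A\times A$ matrix with $P\mathbf k=\mathbf M_{\mathbf k}(\mathbf q)$ for all $\mathbf k\in K\cap\mathbb N^A$ and $\mathbf q\in\mathrm{Loc}(\mathcal N)$ (it exists and does not depend on $\mathbf q$). $\mathcal N$ is critical if the spectral radius of $P$ is $1$, and strongly connected if the digraph on $A$ with an edge $(a,b)$ whenever $P_{ba}>0$ is strongly connected. Components. Two configurations are legally related if there is $\mathbf x_3.\mathbf q_3$ with $\mathbf x_1.\mathbf q_1\to\mathbf x_3.\mathbf q_3$ and $\mathbf x_2.\mathbf q_2\to\mathbf x_3.\mathbf q_3$ (an equivalence relation). A component of the trajectory digraph (the digraph on configurations with an $a$-labelled edge whenever $\mathbf x.\mathbf q\xrightarrow{a}\mathbf x'.\mathbf q'$) is an equivalence class of this relation; $\overline{\mathbf x.\mathbf q}$ is the component of $\mathbf x.\mathbf q$. An infinite walk is a sequence of configurations $\mathbf x_i.\mathbf q_i$ and letters $a_i$ with $\mathbf x_{i-1}.\mathbf q_{i-1}\xrightarrow{a_i}\mathbf x_i.\mathbf q_i$ for consecutive indices in $I$, where $I$ is $\mathbb Z_{\le0}$, $\mathbb Z_{\ge0}$ or $\mathbb Z$; it is diverse if each letter $a\in A$ equals $a_i$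 for infinitely many $i$. A component is recurrent if it contains a diverse infinite walk. $\overline{\mathrm{Rec}}(\mathcal N)$ is the set of recurrent components. Shift monoid and torsion group. $\mathbb N^A$ acts on $\overline{\mathrm{Rec}}(\mathcal N)$ by $\phi(\mathbf n)(\overline{\mathbf x.\mathbf q})=\overline{(\mathbf x+\mathbf n).\mathbf q}$; the shift monoid is $\mathscr M(\mathcal N)=\phi(\mathbb N^A)$. $\mathrm{Tor}(\mathcal N)$ is the torsion subgroup of the Grothendieck group of $\mathscr M(\mathcal N)$. A recurrent component $\overline{\mathbf x.\mathbf q}$ is invertible if for every $g\in\mathrm{Tor}(\mathcal N)$ there is a recurrent component $\overline{\mathbf x'.\mathbf q'}$ such that $\overline{(\mathbf x+\mathbf n).\mathbf q}=\overline{(\mathbf x'+\mathbf n').\mathbf q'}$ for all $\mathbf n,\mathbf n'\in\mathbb N^A$ with $g=\overline{(\phi(\mathbf n),\phi(\mathbf n'))}$. $\mathrm{Tor}(\mathcal N)$ acts on the set of invertible recurrent components by $g\cdot\overline{\mathbf x.\mathbf q}=\overline{\mathbf x'.\mathbf q'}$; the action on $\overline{\mathrm{Rec}}(\mathcal N,m)$ is the restriction of this one (when the components of level $m$ are invertible and form an invariant set). Level. For critical, strongly connected $\mathcal N$, the exchange rate vector $\mathbf s$ is the unique positive integer vector in $\mathbb Z^A$ with $\mathbf s^\top P=\mathbf s^\top$ and $\gcd_a\mathbf s(a)=1$. A configuration $\mathbf x.\mathbf q$ halts if $\mathbf x.\mathbf q\to\mathbf x'.\mathbf q'$ for some $\mathbf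 x'\le\mathbf 0$. $\mathrm{cap}(\mathbf x.\mathbf q)=\sup\{\mathbf s^\top\mathbf z:\mathbf z\in\mathbb Z^A,\ (\mathbf z+\mathbf x).\mathbf q\text{ halts}\}$, $\mathrm{cap}(\mathbf q)=\mathrm{cap}(\mathbf 0.\mathbf q)$, $\mathrm{cap}(\mathcal N)=\max_{\mathbf q\in Q}\mathrm{cap}(\mathbf q)<\infty$, and $\mathrm{lvl}(\mathbf x.\mathbf q)=\mathrm{cap}(\mathcal N)-\mathrm{cap}(\mathbf x.\mathbf q)$. A configuration is recurrent if it has a nonempty legal execution and every configuration $\mathbf x'.\mathbf q'$ legally related to it satisfies $\mathbf x'.\mathbf q'\to\mathbf x.\mathbf q$. Every recurrent component contains a recurrent configuration, and its level is the (common) level of the recurrent configurations it contains. $\overline{\mathrm{Rec}}(\mathcal N,m)$ is the set of recurrent components of level $m$. An action is free if $gx=g'x$ implies $g=g'$, and transitive if the set is nonempty and has a single orbit. *)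

(* Defs.v *)
From HB Require Import structures.
From mathcomp Require Import all_boot all_order all_algebra all_field.
From mathcomp Require Import boolp classical_sets cardinality.

Set Implicit Arguments.
Unset Strict Implicit.
Unset Printing Implicit Defensive.

Import Order.TTheory GRing.Theory Num.Theory.

Local Open Scope ring_scope.
Local Open Scope quotient_scope.
Local Open Scope classical_set_scope.

Section Grothendieck.
Variable M : nmodType.

Definition groth_rel (p p' : M * M) : bool :=
  `[< exists k, p.1 + p'.2 + k = p'.1 + p.2 + k >].

Lemma groth_rel_refl : reflexive groth_rel.
Proof. by move=> p; apply/asboolP; exists 0. Qed.

Lemma groth_rel_sym : symmetric groth_rel.
Proof.
by move=> p p'; apply/asboolP/asboolP => -[k e]; exists k.
Qed.

Lemma groth_rel_trans : transitive groth_rel.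
Proof.
move=> [b b'] [a a'] [c c'] /asboolP[k /= e1] /asboolP[l /= e2].
apply/asboolP; exists (b + b' + k + l) => /=.
transitivity ((a + b' + k) + (b + c' + l)).
  by rewrite (AC (2*4) ((1*4*5)*(3*2*6))).
by rewrite e1 e2 (AC (3*3) ((4*2)*(1*5*3*6))).
Qed.

Canonical groth_equiv :=
  EquivRel groth_rel groth_rel_refl groth_rel_sym groth_rel_trans.

Definition groth := {eq_quot groth_equiv}.

HB.instance Definition _ := Choice.on groth.
HB.instance Definition _ := EqQuotient.on groth.

(* The class of (x, y), that is, the formal difference x - y. *)
Definition groth_class (x y : M) : groth := \pi_groth (x, y).

Lemma groth_classP (x y x' y' : M) :
  groth_class x y = groth_class x' y' <-> exists k, x + y' + k = x' + y + k.
Proof.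
rewrite /groth_class; split => [/eqP|h]; first by rewrite eqmodE => /asboolP.
by apply/eqP; rewrite eqmodE; apply/asboolP.
Qed.

Lemma groth_ind (P : groth -> Prop) :
  (forall x y, P (groth_class x y)) -> forall g, P g.
Proof. by move=> h g; rewrite -[g]reprK; case: (repr g) => x y; exact: h. Qed.

Definition groth_add (g h : groth) : groth :=
  groth_class ((repr g).1 + (repr h).1) ((repr g).2 + (repr h).2).
Definition groth_opp (g : groth) : groth := groth_class (repr g).2 (repr g).1.

Lemma repr_groth_class x y :
  exists k, (repr (groth_class x y)).1 + y + k = x + (repr (groth_class x y)).2 + k.
Proof.
by apply/groth_classP; rewrite /groth_class -surjective_pairing reprK.
Qed.

Lemma groth_add_class x y x' y' :
  groth_add (groth_class x y) (groth_class x' y') = groth_class (x + x') (y + y').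
Proof.
have [k e] := repr_groth_class x y; have [k' e'] := repr_groth_class x' y'.
apply/groth_classP; exists (k + k').
rewrite (AC ((2*2)*2) ((1*3*5)*(2*4*6))) /= e e'.
by rewrite (AC (3*3) ((1*4)*(2*5)*(3*6))).
Qed.

Lemma groth_opp_class x y : groth_opp (groth_class x y) = groth_class y x.
Proof.
have [k e] := repr_groth_class x y.
apply/groth_classP; exists k.
by rewrite [X in X + _ = _]addrC [X in _ = X + _]addrC.
Qed.

Lemma groth_addA : associative groth_add.
Proof.
elim/groth_ind=> x x'; elim/groth_ind=> y y'; elim/groth_ind=> z z'.
by rewrite !groth_add_class !addrA.
Qed.

Lemma groth_addC : commutative groth_add.
Proof.
elim/groth_ind=> x x'; elim/groth_ind=> y y'.
by rewrite !groth_add_class (addrC x) (addrC x').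
Qed.

Lemma groth_add0 : left_id (groth_class 0 0) groth_add.
Proof. by elim/groth_ind=> x x'; rewrite groth_add_class !add0r. Qed.

Lemma groth_addN : left_inverse (groth_class 0 0) groth_opp groth_add.
Proof.
elim/groth_ind=> x x'; rewrite groth_opp_class groth_add_class.
by apply/groth_classP; exists 0; rewrite !addr0 add0r addrC.
Qed.

HB.instance Definition _ :=
  GRing.isZmodule.Build groth groth_addA groth_addC groth_add0 groth_addN.

End Grothendieck.

Section Torsion.
Variable G : zmodType.

Definition is_torsion : {pred G} :=
  [pred g | `[< exists2 d : nat, (0 < d)%N & g *+ d = 0 >]].

Lemma is_torsion_zmod_closed : zmod_closed is_torsion.
Proof.
split=> [|g h /asboolP[d d0 gd] /asboolP[d' d'0 hd]].
  by apply/asboolP; exists 1%N.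
apply/asboolP; exists (d * d')%N; first by rewrite muln_gt0 d0.
by rewrite mulrnBl mulrnA gd mul0rn mulnC mulrnA hd mul0rn subr0.
Qed.

HB.instance Definition _ :=
  GRing.isZmodClosed.Build G is_torsion is_torsion_zmod_closed.

Record torsion := Torsion { torsion_val :> G; _ : torsion_val \in is_torsion }.

HB.instance Definition _ := [isSub for torsion_val].
HB.instance Definition _ := [Choice of torsion by <:].
HB.instance Definition _ := [SubChoice_isSubZmodule of torsion by <:].

End Torsion.

Section Actions.
Variables (G : zmodType) (X : Type) (act : G -> X -> X) (S : set X).

Definition action_on : Prop :=
  [/\ forall g x, S x -> S (act g x),
      forall x, S x -> act 0 x = x &
      forall g h x, S x -> act (g + h) x = act g (act h x)].

Definition free_on : Prop :=
  forall g g' x, S x -> act g x = act g' x -> g = g'.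

Definition transitive_on : Prop :=
  S !=set0 /\ forall x y, S x -> S y -> exists g, act g x = y.

End Actions.

(* Finiteness of the network is built into the types: all alphabets and state *)
(* spaces are finite.  [edge v u] is the type of the edges from v to u.       *)
Record finNetwork := FinNetwork {
  vertex : finType;
  edge : vertex -> vertex -> finType;
  alphabet : vertex -> finType;
  state : vertex -> finType;
  transition : forall v, alphabet v -> state v -> state v;
  message : forall v u, edge v u -> state v -> alphabet v -> seq (alphabet u);
  alphabet_nonempty : forall v, (0 < #|alphabet v|)%N;
  state_nonempty : forall v, (0 < #|state v|)%N;
  transitionC : forall v (a b : alphabet v) (q : state v),
    transition a (transition b q) = transition b (transition a q);
  messageC : forall v u (e : edge v u) (a b : alphabet v) (q : state v),
    perm_eq (message e q a ++ message e (transition a q) b)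
            (message e q b ++ message e (transition b q) a)
}.

Section Network.
Variable N : finNetwork.

Definition letter : finType := {v : vertex N & alphabet v}.
Definition gstate : finType := {dffun forall v : vertex N, state v}.

Implicit Types (a b : letter) (w : seq letter) (q : gstate).

(* Vectors in \mathbb N^A and \mathbb Z^A. *)
Definition nvec := {ffun letter -> nat}.
Definition zvec := {ffun letter -> int}.

HB.instance Definition _ := GRing.Nmodule.on nvec.
HB.instance Definition _ := GRing.Zmodule.on zvec.

Definition nvec_to_zvec (n : nvec) : zvec := [ffun a => (n a)%:Z].
Definition unitz (a : letter) : zvec := [ffun b => (b == a)%:R].

Definition pos_part (z : zvec) : nvec := [ffun a => `|Num.max (z a) 0|%N].
Definition neg_part (z : zvec) : nvec := [ffun a => `|Num.max (- z a) 0|%N].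

Definition lstep a q : gstate :=
  finfun (dfwith q (transition (tagged a) (q (tag a)))).

(* |w| for w \in A^* *)
Definition wcount w : nvec := [ffun a => count_mem a w].

Definition vmsg v (s : state v) (a : alphabet v) : nvec :=
  \sum_(u : vertex N) \sum_(e : edge v u)
    wcount [seq Tagged (@alphabet N) x | x <- message e s a].

Definition lmsg a q : nvec := vmsg (q (tag a)) (tagged a).

(* The first letter of the word acts first. *)
Definition wstep w q : gstate := foldl (fun q a => lstep a q) q w.

Fixpoint wmsg w q : nvec :=
  if w is a :: w' then lmsg a q + wmsg w' (lstep a q) else 0.

(* Since t_w and M_w only depend on |w|, t_n and M_n may be computed with any *)
(* word w such that |w| = n.                                                  *)
Definition word_of (n : nvec) : seq letter :=
  flatten [seq nseq (n a) a | a <- enum letter].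
Definition nstep (n : nvec) := wstep (word_of n).
Definition nmsg (n : nvec) := wmsg (word_of n).

Definition config : Type := (zvec * gstate)%type.
HB.instance Definition _ := Choice.on config.

Implicit Types c : config.

Definition fire a c : config :=
  (c.1 + nvec_to_zvec (lmsg a c.2) - unitz a, lstep a c.2).

Definition wfire w c : config := foldl (fun c a => fire a c) c w.

Fixpoint legal c w : bool :=
  if w is a :: w' then (1 <= c.1 a) && legal (fire a c) w' else true.

Definition exec c w c' : Prop := legal c w /\ wfire w c = c'.
Definition reach c c' : Prop := exists w, exec c w c'.

Definition locally_irreducible : Prop :=
  forall q q', exists w w', wstep w q = wstep w' q'.

Definition transition_monoid : {set {ffun gstate -> gstate}} :=
  [set f | `[< exists w, f = finfun (wstep w) >]]%SET.

Definition end_comp (f g : {ffun gstate -> gstate}) : {ffun gstate -> gstate} :=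
  [ffun q => f (g q)].

(* The monoid is commutative, so that the order of the product is immaterial. *)
Definition loc_idempotent : {ffun gstate -> gstate} :=
  \big[end_comp/[ffun q => q]]_(f in transition_monoid | end_comp f f == f) f.

Definition locally_recurrent : set gstate := range loc_idempotent.

Definition total_kernel : set zvec :=
  [set z | forall q, locally_recurrent q ->
     nstep (pos_part z) q = nstep (neg_part z) q].

(* Entry P_{ab} of a matrix whose rows and columns are indexed by letters. *)
Definition mxentry (R : Type) (P : 'M[R]_#|letter|) a b : R :=
  P (enum_rank a) (enum_rank b).

Definition is_production_matrix (P : 'M[rat]_#|letter|) : Prop :=
  forall (k : nvec) q, total_kernel (nvec_to_zvec k) -> locally_recurrent q ->
    forall a, \sum_b mxentry P a b * (k b)%:R = (nmsg k q a)%:R.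

(* For a locally irreducible network there is exactly one production matrix.  *)
Definition production_matrix : 'M[rat]_#|letter| := xget 0 is_production_matrix.

Definition is_spectral_radius n (P : 'M[rat]_n) (r : algC) : Prop :=
  (exists2 z : algC, eigenvalue (map_mx ratr P) z & `|z| = r) /\
  (forall z : algC, eigenvalue (map_mx ratr P) z -> `|z| <= r).

Definition critical : Prop := is_spectral_radius production_matrix 1.

Definition strongly_connected : Prop :=
  forall a b, connect (fun a b => 0 < mxentry production_matrix b a) a b.

Lemma lstepE a q v : lstep a q v = dfwith q (transition (tagged a) (q (tag a))) v.
Proof. by rewrite /lstep ffunE. Qed.

Lemma lstepC a b q : lstep a (lstep b q) = lstep b (lstep a q).
Proof.
case: a b => [v a] [u b]; apply/ffunP => s; rewrite !lstepE /=.
have [e|nvu] := eqVneq v u.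
  case: u / e b => b; rewrite !dfwith_in.
  have [<-|nvs] := eqVneq v s; first by rewrite !dfwith_in transitionC.
  by rewrite !dfwith_out // !lstepE !dfwith_out.
have nuv : u != v by rewrite eq_sym.
rewrite (dfwith_out _ _ nuv) (dfwith_out _ _ nvu).
have [<-|nvs] := eqVneq v s.
  by rewrite dfwith_in dfwith_out // lstepE dfwith_in.
rewrite dfwith_out // lstepE.
have [<-|nus] := eqVneq u s; first by rewrite !dfwith_in.
by rewrite !dfwith_out // lstepE dfwith_out.
Qed.

Lemma vmsgC v (a b : alphabet v) (s : state v) :
  vmsg s a + vmsg (transition a s) b = vmsg s b + vmsg (transition b s) a.
Proof.
rewrite /vmsg -!big_split; apply: eq_bigr => u _ /=.
rewrite -!big_split; apply: eq_bigr => e _ /=; apply/ffunP => x.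
rewrite !ffunE -[LHS]count_cat -[RHS]count_cat -!map_cat.
exact/permP/perm_map/messageC.
Qed.

Lemma lmsgC a b q : lmsg a q + lmsg b (lstep a q) = lmsg b q + lmsg a (lstep b q).
Proof.
case: a b => [v a] [u b]; rewrite /lmsg !lstepE /=.
have [e|nvu] := eqVneq v u; first by case: u / e b => b; rewrite !dfwith_in vmsgC.
have nuv : u != v by rewrite eq_sym.
by rewrite (dfwith_out _ _ nuv) (dfwith_out _ _ nvu) addrC.
Qed.

Lemma fireC a b c : fire a (fire b c) = fire b (fire a c).
Proof.
case: c => x q; rewrite /fire /= lstepC; congr pair; apply/ffunP => d.
have e : (lmsg b q d)%:Z + (lmsg a (lstep b q) d)%:Z
    = (lmsg a q d)%:Z + (lmsg b (lstep a q) d)%:Z.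
  by rewrite -!PoszD; congr Posz; have /ffunP/(_ d) := lmsgC b a q; rewrite !ffunE.
rewrite !ffunE.
by rewrite (AC 5 ((2*4)*(1*(3*5)))) [RHS](AC 5 ((2*4)*(1*(5*3)))) /= e.
Qed.

Lemma fire_ge a b c : a != b -> c.1 b <= (fire a c).1 b.
Proof.
move=> nab; rewrite !ffunE eq_sym (negPf nab) subr0 lerDl.
by rewrite -natz ler0n.
Qed.

Lemma wfire_cat w w' c : wfire (w ++ w') c = wfire w' (wfire w c).
Proof. by rewrite /wfire foldl_cat. Qed.

Lemma legal_cat c w w' : legal c (w ++ w') = legal c w && legal (wfire w c) w'.
Proof. by elim: w c => //= a w IH c; rewrite IH andbA. Qed.

Lemma reach_refl c : reach c c.
Proof. by exists [::]. Qed.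

Lemma reach_trans c2 c1 c3 : reach c1 c2 -> reach c2 c3 -> reach c1 c3.
Proof.
move=> [w [l1 e1]] [w' [l2 e2]]; exists (w ++ w'); split.
  by rewrite legal_cat l1 e1.
by rewrite wfire_cat e1.
Qed.

Lemma exec_diamond c a w :
  1 <= c.1 a -> legal c w ->
  exists2 c', reach (fire a c) c' & reach (wfire w c) c'.
Proof.
elim: w c => [|b w IH] c ha /=.
  by move=> _; exists (fire a c); [exact: reach_refl | exists [:: a]; split=> //=; rewrite ha].
case/andP=> hb hw; have [eab|nab] := eqVneq a b.
  by subst b; exists (wfire w (fire a c)); [exists w | exact: reach_refl].
have hba : b != a by rewrite eq_sym.
have [c' r1 r2] := IH (fire b c) (le_trans ha (fire_ge c hba)) hw.
exists c' => //; apply: reach_trans r1; exists [:: b]; split; last by rewrite /= fireC.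
by rewrite /= andbT; exact: le_trans hb (fire_ge c nab).
Qed.

Lemma reach_confluent c c1 c2 :
  reach c c1 -> reach c c2 -> exists2 c3, reach c1 c3 & reach c2 c3.
Proof.
move=> [w [lw <-]]; elim: w c c2 lw => [|a w IH] c c2 /=.
  by move=> _ r; exists c2 => //; exact: reach_refl.
case/andP=> ha lw [w' [lw' e']].
have [c' r1 r2] := exec_diamond ha lw'.
have [c3 r3 r4] := IH _ _ lw r1.
by exists c3 => //; apply: reach_trans r4; rewrite -e'.
Qed.

Definition legally_related c1 c2 : bool :=
  `[< exists2 c3, reach c1 c3 & reach c2 c3 >].

Lemma legally_related_refl : reflexive legally_related.
Proof. by move=> c; apply/asboolP; exists c; exact: reach_refl. Qed.

Lemma legally_related_sym : symmetric legally_related.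
Proof. by move=> c c'; apply/asboolP/asboolP => -[d ? ?]; exists d. Qed.

Lemma legally_related_trans : transitive legally_related.
Proof.
move=> c2 c1 c3 /asboolP[d r1 r2] /asboolP[d' r2' r3].
have [e re re'] := reach_confluent r2 r2'.
by apply/asboolP; exists e; [exact: reach_trans re | exact: reach_trans re'].
Qed.

Canonical legally_related_equiv :=
  EquivRel legally_related legally_related_refl legally_related_sym
           legally_related_trans.

(* The components of the trajectory digraph. *)
Definition component := {eq_quot legally_related_equiv}.

HB.instance Definition _ := Choice.on component.
HB.instance Definition _ := EqQuotient.on component.

Definition comp c : component := \pi_component c.

Lemma compP c c' : comp c = comp c' <-> legally_related c c'.
Proof.
rewrite /comp; split=> [/eqP|h]; first by rewrite eqmodE.
by apply/eqP; rewrite eqmodE.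
Qed.

(* The index set I of an infinite walk is the set of nonpositive integers,    *)
(* the set of nonnegative integers, or the set of all integers.               *)
Definition walk_index (I : set int) : Prop :=
  [\/ I = [set i | i <= 0], I = [set i | 0 <= i] | I = setT].

Definition is_walk (I : set int) (x : int -> config) (l : int -> letter) : Prop :=
  forall i, I (i - 1) -> I i -> exec (x (i - 1)) [:: l i] (x i).

Definition diverse (I : set int) (l : int -> letter) : Prop :=
  forall a, infinite_set [set i | [/\ I (i - 1), I i & l i = a]].

Definition recurrent_component (C : component) : Prop :=
  exists I (x : int -> config) (l : int -> letter),
    [/\ walk_index I, is_walk I x l, diverse I l &
        forall i, I i -> comp (x i) = C].

(* \overline{Rec}(N) *)
Definition rec_component := {C : component | `[< recurrent_component C >]}.

HB.instance Definition _ := Choice.on rec_component.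
HB.instance Definition _ := SubType.on rec_component.

Definition addc (n : nvec) c : config := (c.1 + nvec_to_zvec n, c.2).

Lemma addc0 c : addc 0 c = c.
Proof.
case: c => x q; rewrite /addc; congr pair; apply/ffunP => a.
by rewrite !ffunE addr0.
Qed.

Lemma addcD n n' c : addc (n + n') c = addc n (addc n' c).
Proof.
rewrite /addc /=; congr pair; apply/ffunP => a.
by rewrite !ffunE PoszD (addrC (Posz (n a))) addrA.
Qed.

Lemma fire_addc n a c : fire a (addc n c) = addc n (fire a c).
Proof.
rewrite /fire /addc /=; congr pair; apply/ffunP => b.
by rewrite !ffunE (AC (3*1) (1*3*4*2)).
Qed.

Lemma exec_addc n c w c' : exec c w c' -> exec (addc n c) w (addc n c').
Proof.
case; elim: w c => [|a w IH] c /=; first by move=> _ <-.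
case/andP=> ha lw e; have [lw' e'] := IH _ lw e.
split; last by rewrite /= fire_addc.
rewrite /= fire_addc lw' andbT; apply: le_trans ha _.
by rewrite !ffunE lerDl -natz ler0n.
Qed.

Lemma comp_addc n c c' : comp c = comp c' -> comp (addc n c) = comp (addc n c').
Proof.
move/compP/asboolP=> [d [w e] [w' e']]; apply/compP/asboolP.
by exists (addc n d); [exists w | exists w']; exact: exec_addc.
Qed.

Definition shift_component (n : nvec) (C : component) : component :=
  comp (addc n (repr C)).

Lemma shift_comp n c : shift_component n (comp c) = comp (addc n c).
Proof. by apply: comp_addc; rewrite /comp reprK. Qed.

Lemma shift_recurrent n C :
  recurrent_component C -> recurrent_component (shift_component n C).
Proof.
move=> [I [x [l [hI hw hd hc]]]].
exists I, (fun i => addc n (x i)), l; split=> // i hi.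
  by move=> hi'; apply: exec_addc; exact: hw.
by rewrite -(hc i hi) shift_comp.
Qed.

Lemma shift_rec_subproof n (C : rec_component) :
  `[< recurrent_component (shift_component n (val C)) >].
Proof. by case: C => C /= /asboolP h; apply/asboolP; exact: shift_recurrent. Qed.

(* The action of \mathbb N^A on the recurrent components. *)
Definition shift_rec (n : nvec) (C : rec_component) : rec_component :=
  exist _ (shift_component n (val C)) (shift_rec_subproof n C).

Lemma shift_rec0 C : shift_rec 0 C = C.
Proof.
apply: val_inj; rewrite /= -[in LHS](reprK (val C)) -/(comp _) shift_comp addc0.
by rewrite /comp reprK.
Qed.

Lemma shift_recD n n' C : shift_rec (n + n') C = shift_rec n (shift_rec n' C).
Proof.
apply: val_inj; rewrite /= -[in LHS](reprK (val C)) -[in RHS](reprK (val C)).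
by rewrite -!/(comp _) !shift_comp addcD.
Qed.

(* The shift monoid, written additively; its law is the composition of maps. *)
Record shift_monoid := ShiftMonoid {
  shift_fun :> rec_component -> rec_component;
  _ : `[< exists n, shift_fun = shift_rec n >]
}.

HB.instance Definition _ := [isSub for shift_fun].
HB.instance Definition _ := [Choice of shift_monoid by <:].

Lemma phi_subproof n : `[< exists n', shift_rec n = shift_rec n' >].
Proof. by apply/asboolP; exists n. Qed.

Definition phi (n : nvec) : shift_monoid := ShiftMonoid (phi_subproof n).

Lemma phi_surj (f : shift_monoid) : exists n, f = phi n.
Proof. by case: f => f h; have /asboolP[n e] := h; exists n; apply: val_inj. Qed.

Lemma shift_mul_subproof (f g : shift_monoid) :
  `[< exists n, (f \o g : rec_component -> rec_component) = shift_rec n >].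
Proof.
have [n ->] := phi_surj f; have [n' ->] := phi_surj g.
by apply/asboolP; exists (n + n'); apply/funext => C; rewrite shift_recD.
Qed.

Definition shift_mul (f g : shift_monoid) : shift_monoid :=
  ShiftMonoid (shift_mul_subproof f g).

Lemma phiD_mul n n' : phi (n + n') = shift_mul (phi n) (phi n').
Proof. by apply: val_inj; apply/funext => C; exact: shift_recD. Qed.

Lemma shift_mulA : associative shift_mul.
Proof. by move=> f g h; apply: val_inj. Qed.

Lemma shift_mulC : commutative shift_mul.
Proof.
move=> f g; have [n ->] := phi_surj f; have [n' ->] := phi_surj g.
by rewrite -!phiD_mul addrC.
Qed.

Lemma shift_mul0 : left_id (phi 0) shift_mul.
Proof. by move=> f; apply: val_inj; apply/funext => C; exact: shift_rec0. Qed.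

HB.instance Definition _ :=
  GRing.isNmodule.Build shift_monoid shift_mulA shift_mulC shift_mul0.

Lemma phiD n n' : phi (n + n') = phi n + phi n'.
Proof. exact: phiD_mul. Qed.

Lemma phi0 : phi 0 = 0.
Proof. by []. Qed.

Definition Tor : zmodType := torsion (groth shift_monoid).

(* The recurrent components that may be taken as the value of g . C *)
Definition tor_image (g : Tor) (C : rec_component) : set rec_component :=
  [set C' | forall n n' : nvec,
     torsion_val g = groth_class (phi n) (phi n') -> phi n C = phi n' C'].

Definition invertible (C : rec_component) : Prop :=
  forall g : Tor, tor_image g C !=set0.

Definition tor_act (g : Tor) (C : rec_component) : rec_component :=
  xget C (tor_image g C).

Definition is_exchange_rate (s : zvec) : Prop :=
  [/\ forall a, 0 < s a,
      forall b, \sum_a (s a)%:~R * mxentry production_matrix a b = (s b)%:~R &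
      \big[gcdn/0%N]_a `|s a|%N = 1%N].

(* Unique when the network is critical and strongly connected.                *)
Definition exchange_rate : zvec := xget 0 is_exchange_rate.

Definition halts c : Prop := exists2 c', reach c c' & forall a, c'.1 a <= 0.

(* [cap] and [network_cap] are suprema in the integers of sets that are       *)
(* nonempty and, for critical strongly connected networks, bounded above.     *)
Definition cap c : int :=
  supremum 0 [set \sum_a exchange_rate a * z a |
    z in [set z : zvec | halts (z + c.1, c.2)]].

Definition network_cap : int := supremum 0 [set cap (0, q) | q in setT].

Definition level c : int := network_cap - cap c.

Definition recurrent_config c : Prop :=
  (exists2 w, w != [::] & legal c w) /\
  (forall c', legally_related c' c -> reach c' c).

(* \overline{Rec}(N, m) *)
Definition rec_level (m : int) : set rec_component :=
  [set C | exists c, [/\ recurrent_config c, comp c = val C & level c = m]].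

(* On the components of level m, each g . C exists and is unique, so that     *)
(* [tor_act g C] is the value of the action and not a default value.          *)
Definition tor_act_defined (m : int) : Prop :=
  forall C, rec_level m C ->
    invertible C /\ forall g : Tor, is_subset1 (tor_image g C).

End Network.

(* Main.v *)
Require Import Defs.
From mathcomp Require Import all_boot all_order all_algebra all_field.
From mathcomp Require Import boolp classical_sets cardinality.
From mathcomp Require Import ring zify.

Set Implicit Arguments.
Unset Strict Implicit.
Unset Printing Implicit Defensive.

(** Firing, legal or not, acts invertibly on the configurations with locally
    recurrent state, and adding y in Z^A to the letters keeps such a
    configuration in its firing orbit exactly when y lies in the subgroup
    L = (P - I)K.  An orbit whose level exceeds a fixed bound consists of
    nonhalting configurations; each of them has, by the pigeonhole principle,
    legal executions containing any prescribed number of each letter, and such an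
    execution can absorb an illegal firing word, because deleting that word from
    it leaves an execution that is legal after the word has been fired.  Hence at
    large level the recurrent components are exactly the orbits, and they form a
    torsor under ker(s)/L.  The Grothendieck group of the shift monoid is Z^A/L;
    finiteness of the set of components of a given level shows that its torsion
    subgroup is ker(s)/L.  The spectral radius enters through the existence of
    the positive exchange rate vector s. *)

Import Order.TTheory GRing.Theory Num.Theory.

Local Open Scope ring_scope.
Local Open Scope classical_set_scope.

(** * Nonnegative irreducible matrices *)

(** Bernoulli bounds (1 + e)^j below by e (j + 1), as e <= 1. Raising this to a power larger than D
    beats the polynomial bound. *)
Lemma exp_not_poly (e C : algC) D : 0 < e -> e <= 1 ->
  (forall k : nat, (1 + e) ^+ k <= C * k.+1%:R ^+ D) -> False.
Proof.
move=> e0 e1 h.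
have C0 : 0 <= C.
  by apply: le_trans (_ : 1 <= C); rewrite ?ler01 //; have := h 0%N; rewrite expr0 expr1n mulr1.
have bern j : 1 + e *+ j <= (1 + e) ^+ j.
  elim: j => [|j IH]; first by rewrite mulr0n addr0 expr0.
  rewrite exprS; apply: (@le_trans _ _ ((1 + e) * (1 + e *+ j))); last first.
    by rewrite ler_wpM2l // addr_ge0 ?ler01 // ltW.
  have -> : (1 + e) * (1 + e *+ j) = 1 + e *+ j.+1 + e * (e *+ j) by rewrite mulrS; ring.
  by rewrite lerDl mulr_ge0 ?mulrn_wge0 // ltW.
(* The hypothesis is used at k = j d; after cancelling (j + 1)^D one factor j + 1 survives on the
   left, against a constant. *)
set d := D.+1.
have key j : j.+1%:R * e ^+ d <= C * d%:R ^+ D.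
  have h1 : (e * j.+1%:R) ^+ d <= ((1 + e) ^+ j) ^+ d.
    apply: lerXn2r; rewrite ?nnegrE; [by rewrite mulr_ge0 ?ler0n ?ltW| |].
      by rewrite exprn_ge0 // addr_ge0 ?ler01 ?ltW.
    apply: le_trans (bern j); rewrite mulr_natr mulrS lerD2r //.
  have h2 : ((1 + e) ^+ j) ^+ d <= C * (d%:R * j.+1%:R) ^+ D.
    rewrite -exprM; apply: le_trans (h _) _; rewrite ler_wpM2l //.
    apply: lerXn2r; rewrite ?nnegrE ?ler0n //; first by rewrite mulr_ge0 ?ler0n.
    by rewrite -natrM ler_nat /d; nia.
  have := le_trans h1 h2; rewrite !exprMn [j.+1%:R ^+ d]exprS mulrA mulrA ler_pM2r; last first.
    by rewrite exprn_gt0 ?ltr0n.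
  by rewrite mulrC.
have ed : 0 < e ^+ d by rewrite exprn_gt0.
have Q0 : 0 <= C * d%:R ^+ D / e ^+ d.
  by rewrite divr_ge0 ?(ltW ed) // mulr_ge0 // exprn_ge0 ?ler0n.
have := archi_boundP Q0; set b := Num.Def.archi_bound _ => hb.
have := key b; rewrite -ler_pdivlMr // => hk.
have := le_lt_trans hk hb; rewrite ltr_nat; lia.
Qed.

(** Each root z costs one degree: v (P - z) is killed by the remaining factors, and v P^(k+1) = z v
    P^k + v (P - z) P^k with |z| <= 1, so the bounds for v (P - z) are summed over k. *)
Lemma horner_poly_growth n (P : 'M[algC]_n.+1) (rs : seq algC) :
  (forall z, z \in rs -> `|z| <= 1) ->
  forall v : 'rV_n.+1, v *m horner_mx P (\prod_(z <- rs) ('X - z%:P)) = 0 ->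
  forall j, exists C : algC, exists D, 0 <= C /\
    forall k, `|(v *m P ^+ k) 0 j| <= C * k.+1%:R ^+ D.
Proof.
elim: rs => [|z rs IH] hz v.
  rewrite big_nil rmorph1 mulmx1 => -> j; exists 0, 0%N; split=> // k.
  by rewrite mul0mx mxE normr0 mul0r.
rewrite big_cons rmorphM /= mulmxA => hv j.
have [|C [D [C0 hC]]] := IH _ _ hv j.
  by move=> y hy; apply: hz; rewrite inE hy orbT.
exists (`|v 0 j| + C), D.+1; split; first by rewrite addr_ge0.
have step k : `|(v *m P ^+ k) 0 j| <= `|v 0 j| + C * k%:R * k.+1%:R ^+ D.
  elim: k => [|k IHk]; first by rewrite expr0 mulmx1 mulr0 mul0r addr0.
  have e : v *m P ^+ k.+1 = z *: (v *m P ^+ k) +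
      v *m horner_mx P ('X - z%:P) *m P ^+ k.
    have eS : P ^+ k.+1 = P *m P ^+ k by rewrite exprS.
    rewrite rmorphB /= horner_mx_X horner_mx_C mulmxBr mulmxBl eS mulmxA.
    by rewrite mul_mx_scalar -scalemxAl addrC subrK.
  rewrite e mxE; apply: le_trans (ler_normD _ _) _.
  apply: (@le_trans _ _ (`|v 0 j| + C * k%:R * k.+1%:R ^+ D + C * k.+1%:R ^+ D)).
    apply: lerD (hC k); apply: le_trans IHk.
    by rewrite mxE normrM ler_piMl // hz // mem_head.
  rewrite -addrA lerD2l -mulrA -mulrDr -mulrA ler_wpM2l //.
  rewrite -[X in _ + X]mul1r -mulrDl natr1 ler_wpM2l ?ler0n //.
  by apply: lerXn2r; rewrite ?nnegrE ?ler0n // ler_nat.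
move=> k; apply: le_trans (step k) _; rewrite mulrDl; apply: lerD.
  by rewrite ler_peMr // exprn_ege1 // ler1n.
rewrite -mulrA ler_wpM2l // exprS ler_wpM2r ?exprn_ge0 ?ler0n //.
by rewrite ler_nat.
Qed.

Lemma poly_growth n (P : 'M[algC]_n.+1) :
  (forall z, eigenvalue P z -> `|z| <= 1) ->
  forall (v : 'rV_n.+1) j, exists C : algC, exists D,
    forall k, `|(v *m P ^+ k) 0 j| <= C * k.+1%:R ^+ D.
Proof.
move=> hP v j; have [rs e] := closed_field_poly_normal (char_poly P).
have {}e : char_poly P = \prod_(z <- rs) ('X - z%:P).
  by rewrite e (monicP (char_poly_monic P)) scale1r.
have [||C [D [_ h]]] := @horner_poly_growth _ P rs _ v _ j; last by exists C, D.
  move=> z hz; apply: hP; rewrite eigenvalue_root_char e; rewrite root_prod_XsubC //.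
by rewrite -e Cayley_Hamilton mulmx0.
Qed.

(* If y P <> y, irreducibility yields e > 0 with (y R) P >= (1 + e) y R for a      *)
(* positive R commuting with P, so that y R P^k grows exponentially, whereas      *)
(* Cayley-Hamilton only allows polynomial growth.                                 *)
Lemma superharmonic_eq n (P : 'M[algC]_n.+1) (y : 'rV[algC]_n.+1) :
  (forall i j, 0 <= P i j) -> (forall i j, exists k, 0 < (P ^+ k) i j) ->
  (forall z, eigenvalue P z -> `|z| <= 1) ->
  (forall j, 0 <= y 0 j) -> (forall j, y 0 j <= (y *m P) 0 j) -> y *m P = y.
Proof.
move=> P0 irr hP y0 hy.
have Pk0 k i j : 0 <= (P ^+ k) i j.
  elim: k i j => [|k IH] i j; first by rewrite expr0 mxE; case: eqP => // _; exact: ler01.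
  by rewrite exprS mxE sumr_ge0 // => l _; rewrite mulr_ge0.
have mono (R : 'M_n.+1) (u v : 'rV_n.+1) : (forall i j, 0 <= R i j) ->
    (forall j, u 0 j <= v 0 j) -> forall j, (u *m R) 0 j <= (v *m R) 0 j.
  by move=> R0 huv j; rewrite !mxE; apply: ler_sum => i _; rewrite ler_wpM2r.
have [K hK] : exists K : 'I_n.+1 -> 'I_n.+1 -> nat, forall i j, 0 < (P ^+ K i j) i j.
  apply: (@fin_all_exists _ (fun=> _) (fun i (K : _ -> nat) => forall j, 0 < (P ^+ K j) i j)).
  by move=> i; apply: (@fin_all_exists _ (fun=> nat) (fun j k => 0 < (P ^+ k) i j)).
(* Summing the powers up to M makes [R] entrywise positive; it commutes with P and spreads the
   strict gap at one coordinate to all of them. *)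
pose M := (\max_i \max_j K i j)%N.
pose R := \sum_(k < M.+1) P ^+ k.
have R0 i j : 0 < R i j.
  have hM : (K i j < M.+1)%N.
    rewrite ltnS; apply: leq_trans (leq_bigmax i).
    by apply: (leq_bigmax (F := K i) j).
  rewrite summxE (bigD1 (Ordinal hM)) //=.
  by apply: ltr_wpDr (hK _ _); apply: sumr_ge0 => k _; exact: Pk0.
apply/eqP/negPn/negP => ne.
have [j0 hj0] : exists j, y 0 j < (y *m P) 0 j.
  have [j hj] : exists j, y 0 j != (y *m P) 0 j.
    apply/existsP; rewrite -negb_forall; apply: contra ne => /forallP h.
    by apply/eqP/rowP => j; apply/esym/eqP.
  by exists j; rewrite lt_neqAle hj hy.
pose u := y *m R.
have u1 j : u 0 j < (u *m P) 0 j.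
  have PR : P *m R = R *m P.
    rewrite /R mulmx_sumr mulmx_suml; apply: eq_bigr => k _.
    by rewrite -[LHS]/(P * P ^+ k) -[RHS]/(P ^+ k * P) -exprS -exprSr.
  rewrite /u -mulmxA -PR mulmxA -subr_gt0.
  have subE (a b : 'rV[algC]_n.+1) i : (a - b) 0 i = a 0 i - b 0 i by rewrite mxE [X in _ + X]mxE.
  rewrite -subE -mulmxBl.
  rewrite mxE (bigD1 j0) //=; apply: ltr_wpDr.
    apply: sumr_ge0 => i _; rewrite mulr_ge0 ?(ltW (R0 _ _)) //.
    by rewrite subE subr_ge0 hy.
  by rewrite mulr_gt0 // subE subr_gt0.
have [i0 hi0] : exists i, 0 < y 0 i.
  have [/existsP //|/existsPn y_le0] := boolP [exists i, 0 < y 0 i].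
  have : (y *m P) 0 j0 = 0.
    rewrite mxE big1 // => i _; have := y_le0 i.
    by rewrite lt_neqAle y0 andbT negbK => /eqP <-; rewrite mul0r.
  by move=> e; move: hj0; rewrite e => /(le_lt_trans (y0 _)); rewrite ltxx.
have u_gt0 j : 0 < u 0 j.
  rewrite mxE (bigD1 i0) //=; apply: ltr_wpDr; last exact: mulr_gt0.
  by apply: sumr_ge0 => i _; rewrite mulr_ge0 ?(ltW (R0 _ _)).
have [e [e0 e1 he]] : exists e : algC, [/\ 0 < e, e <= 1 &
    forall j, (1 + e) * u 0 j <= (u *m P) 0 j].
  (* The inverse of 1 plus the sum of the inverses of the [x j] lies below 1 and below every [x j],
     which avoids a minimum in [algC]. *)
  pose x j := (u *m P) 0 j / u 0 j - 1.
  have x0 j : 0 < x j by rewrite subr_gt0 ltr_pdivlMr ?mul1r // u_gt0.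
  have S0 (i : 'I_n.+1) : (x i)^-1 <= 1 + \sum_j (x j)^-1.
    rewrite (bigD1 i) //= addrCA lerDl addr_ge0 ?ler01 // sumr_ge0 // => j _.
    by rewrite invr_ge0 ltW.
  have S1 : 1 <= 1 + \sum_j (x j)^-1.
    by rewrite lerDl sumr_ge0 // => j _; rewrite invr_ge0 ltW.
  have Sp : 0 < 1 + \sum_j (x j)^-1 by apply: lt_le_trans S1.
  exists (1 + \sum_j (x j)^-1)^-1; split; rewrite ?invr_gt0 ?invf_le1 //.
  move=> j; rewrite -ler_pdivlMr ?u_gt0 // addrC -lerBrDr.
  by rewrite -/(x j) -[x j]invrK lef_pV2 ?posrE ?invr_gt0 ?x0 ?S0.
have e10 : 0 <= 1 + e by exact: addr_ge0 ler01 (ltW e0).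
have [C [D hCD]] := poly_growth hP u 0.
apply: (@exp_not_poly e (C / u 0 0) D) => // k.
rewrite mulrAC ler_pdivlMr //; apply: le_trans (hCD k).
have H : forall j, (1 + e) ^+ k * u 0 j <= (u *m P ^+ k) 0 j.
  elim: {hCD} k => [|k IH] j; first by rewrite expr0 mul1r mulmx1.
  have -> : u *m P ^+ k.+1 = u *m P ^+ k *m P by rewrite exprSr mulmxA.
  apply: (@le_trans _ _ (((1 + e) ^+ k *: u *m P) 0 j)); last first.
    by apply: mono => // i; rewrite mxE.
  rewrite -scalemxAl [X in _ <= X]mxE exprSr -mulrA ler_wpM2l // ?exprn_ge0 //.
apply: le_trans (H 0) _; apply: real_ler_norm; apply: ger0_real; apply: le_trans (H 0).
by rewrite mulr_ge0 ?exprn_ge0 ?(ltW (u_gt0 _)).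
Qed.

(** The moduli y of an eigenvector for |z| = 1 satisfy y <= y P, hence y P = y. So 1 is an
    eigenvalue over algC and therefore over the rationals; the moduli of a rational eigenvector are
    fixed in the same way, and irreducibility makes them positive. *)
Lemma perron_left n (P : 'M[rat]_n) :
  (forall i j, 0 <= P i j) -> (forall i j, exists k, 0 < (P ^+ k) i j) ->
  is_spectral_radius P 1 ->
  exists s : 'rV[rat]_n, (forall j, 0 < s 0 j) /\ s *m P = s.
Proof.
case: n P => [|n] P P0 irr [[z /eigenvalueP[v hv v0] z1] hP].
  by move: v0; rewrite (thinmx0 v) eqxx.
pose f : {rmorphism rat -> algC} := ratr.
have ratr0 (x : rat) : (0 <= x) = (0 <= f x) by rewrite ler0q.
have PC0 i j : 0 <= map_mx f P i j by rewrite mxE -ratr0.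
have irrC i j : exists k, 0 < (map_mx f P ^+ k) i j.
  by have [k hk] := irr i j; exists k; rewrite -rmorphXn /= mxE ltr0q.
have super (y : 'rV[algC]_n.+1) := superharmonic_eq (y := y) PC0 irrC hP.
pose y : 'rV_n.+1 := \row_j `|v 0 j|.
have yP : y *m map_mx f P = y.
  apply: super => j; first by rewrite mxE.
  have /rowP/(_ j) := hv; rewrite !mxE => hj.
  have -> : `|v 0 j| = `|z * v 0 j| by rewrite normrM z1 mul1r.
  rewrite -hj; apply: le_trans (ler_norm_sum _ _ _) _; apply: ler_sum => i _.
  rewrite normrM ?mxE [X in _ * X <= _]ger0_norm ?ler0q //.
have : eigenvalue (map_mx f P) (f 1).
  apply/eigenvalueP; exists y; rewrite ?rmorph1 ?scale1r //.
  apply: contra v0 => /eqP/rowP y0; apply/eqP/rowP => j.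
  by have := y0 j; rewrite !mxE => /eqP; rewrite normr_eq0 => /eqP.
rewrite eigenvalue_map => /eigenvalueP[t]; rewrite scale1r => ht t0.
pose s : 'rV[rat]_n.+1 := \row_j `|t 0 j|.
have s0 j : 0 <= s 0 j by rewrite mxE.
have sP : s *m P = s.
  apply: (@map_mx_inj _ _ f); rewrite map_mxM; apply: super => j.
    by rewrite mxE -ratr0.
  rewrite -map_mxM [X in X <= _]mxE [X in _ <= X]mxE ler_rat.
  have /rowP/(_ j) := ht; rewrite !mxE => <-.
  apply: le_trans (ler_norm_sum _ _ _) _; apply: ler_sum => i _.
  by rewrite normrM mxE (ger0_norm (P0 i j)).
have [i hi] : exists i, 0 < s 0 i.
  have [i hi] : exists i, t 0 i != 0.
    apply/existsP; rewrite -negb_forall; apply: contra t0 => /forallP h.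
    by apply/eqP/rowP => i; rewrite [RHS]mxE; apply/eqP; move: (h i).
  by exists i; rewrite mxE normr_gt0.
exists s; split=> // j; have [k hk] := irr i j.
have -> : s = s *m P ^+ k.
  by elim: {hk} k => [|k IH]; [rewrite mulmx1 | rewrite exprS mulmxA sP].
rewrite mxE (bigD1 i) //=; apply: ltr_wpDr; last exact: mulr_gt0.
apply: sumr_ge0 => l _; rewrite mulr_ge0 //.
elim: k l {hk} => [|k IH] l; first by rewrite expr0 mxE; case: eqP.
by rewrite exprS mxE sumr_ge0 // => m _; rewrite mulr_ge0.
Qed.

(** * Words and legal executions *)

Section Words.
Variable N : finNetwork.
Implicit Types (a b : letter N) (u v w : seq (letter N)) (q : gstate N) (c : config N).

Definition addz (y : zvec N) c : config N := (c.1 + y, c.2).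

Lemma addcE (n : nvec N) c : addc n c = addz (nvec_to_zvec n) c.
Proof. by []. Qed.

Lemma addz0 c : addz 0 c = c.
Proof. by case: c => x q; rewrite /addz addr0. Qed.

Lemma addzD y z c : addz (y + z) c = addz y (addz z c).
Proof. by rewrite /addz /= (addrC y) addrA. Qed.

Lemma nvec_to_zvecD : {morph @nvec_to_zvec N : n m / n + m}.
Proof. by move=> n m; apply/ffunP => a; rewrite !ffunE. Qed.

Lemma nvec_to_zvec0 : @nvec_to_zvec N 0 = 0.
Proof. by apply/ffunP => a; rewrite !ffunE. Qed.

Lemma nvec_to_zvecMn (n : nvec N) d : nvec_to_zvec (n *+ d) = nvec_to_zvec n *+ d.
Proof.
elim: d => [|d IH]; first by rewrite !mulr0n nvec_to_zvec0.
by rewrite !mulrS nvec_to_zvecD IH.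
Qed.

Lemma fire_addz y a c : fire a (addz y c) = addz y (fire a c).
Proof.
rewrite /fire /addz /=; congr pair; apply/ffunP => b.
by rewrite !ffunE (AC (3*1) (1*3*4*2)).
Qed.

Lemma wfire_addz y w c : wfire w (addz y c) = addz y (wfire w c).
Proof. by elim: w c => //= a w IH c; rewrite fire_addz IH. Qed.

Lemma wstep_cat w w' q : wstep (w ++ w') q = wstep w' (wstep w q).
Proof. by rewrite /wstep foldl_cat. Qed.

Lemma wmsg_cat w w' q : wmsg (w ++ w') q = wmsg w q + wmsg w' (wstep w q).
Proof.
elim: w q => [|a w IH] q /=; first by rewrite add0r.
by rewrite IH addrA.
Qed.

Lemma wfireE w c :
  wfire w c = addz (nvec_to_zvec (wmsg w c.2) - nvec_to_zvec (wcount w))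
                   (c.1, wstep w c.2).
Proof.
elim: w c => [|a w IH] [x q] /=.
  rewrite /addz /=; congr pair; apply/ffunP => b; rewrite !ffunE /=.
  by rewrite addr0.
rewrite IH /addz /=; congr pair; apply/ffunP => b; rewrite !ffunE /=.
rewrite !PoszD (eq_sym a); case: eqP => _ /=; lia.
Qed.

Lemma wfire_rem a w c : a \in w -> wfire (rem a w) (fire a c) = wfire w c.
Proof.
elim: w c => //= b w IH c; rewrite inE eq_sym; case: eqP => [-> //|_ /= aw].
by rewrite fireC IH.
Qed.

Lemma wfire_perm w w' c : perm_eq w w' -> wfire w c = wfire w' c.
Proof.
elim: w w' c => [|a w IH] w' c h.
  by move: (perm_size h); case: w' {h}.
have aw' : a \in w' by rewrite -(perm_mem h) mem_head.
rewrite /= -(wfire_rem _ aw'); apply: IH.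
by rewrite -(perm_cons a); apply: perm_trans h (perm_to_rem aw').
Qed.

Lemma wstep_perm w w' q : perm_eq w w' -> wstep w q = wstep w' q.
Proof.
by move=> h; have := wfire_perm (0, q) h; rewrite !wfireE => -[_ ->].
Qed.

Lemma wcount_perm w w' : perm_eq w w' <-> wcount w = wcount w'.
Proof.
split=> [/permP h|/ffunP h]; first by apply/ffunP => a; rewrite !ffunE h.
by apply/allP => a _ /=; have := h a; rewrite !ffunE => ->.
Qed.

Lemma wmsg_perm w w' q : perm_eq w w' -> wmsg w q = wmsg w' q.
Proof.
move=> h; have := wfire_perm (0, q) h; rewrite !wfireE => -[/ffunP e _].
have {}h := (wcount_perm w w').1 h; rewrite h in e.
apply/ffunP => a; have := e a; rewrite !ffunE; lia.
Qed.

Lemma sub_word v u : (forall a, (count_mem a v <= count_mem a u)%N) ->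
  exists u', perm_eq (v ++ u') u.
Proof.
elim: v u => [|a v IH] u h; first by exists u.
have au : a \in u.
  by rewrite -has_pred1 has_count; apply: leq_trans (h a); rewrite /= eqxx.
have pu := perm_to_rem au.
have [|u' hu'] := IH (rem a u).
  move=> b; have := h b; have /permP -> := pu; rewrite /=; lia.
by exists u'; rewrite perm_sym (perm_trans pu) // perm_sym /= perm_cons.
Qed.

(** Firing [a] early lowers only the count of [a], and before its first occurrence in [w] no letter
    [a] is needed. The firing of [a] itself may be illegal. *)
Lemma legal_rem a w c : legal c w -> a \in w -> legal (fire a c) (rem a w).
Proof.
elim: w c => //= b w IH c /andP[hb hw]; rewrite inE (eq_sym a).
have [eba|nab /= aw] := eqVneq b a; first by move: hw; rewrite eba.
by rewrite (le_trans hb (fire_ge _ _)) 1?eq_sym //= fireC IH.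
Qed.

(** The absorption principle: once [v] has been fired, legally or not, what remains of [u] is legal
    and leads to the same end. *)
Lemma legal_remove c u v : legal c u ->
  (forall a, (count_mem a v <= count_mem a u)%N) -> reach (wfire v c) (wfire u c).
Proof.
elim: v c u => [|a v IH] c u hu h; first by exists u.
have au : a \in u.
  by rewrite -has_pred1 has_count; apply: leq_trans (h a); rewrite /= eqxx.
rewrite /= -(wfire_rem c au); apply: IH; first exact: legal_rem.
by move=> b; have := h b; have /permP -> := perm_to_rem au; rewrite /=; lia.
Qed.

Lemma fire_ge_pred a c b : c.1 b - (b == a)%:R <= (fire a c).1 b.
Proof. by rewrite !ffunE addrAC lerDl -natz ler0n. Qed.

Lemma wfire_notin_ge a v c : a \notin v -> c.1 a <= (wfire v c).1 a.
Proof.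
elim: v c => //= b v IH c; rewrite inE negb_or => /andP[nab av].
apply: le_trans (IH _ av); apply: le_trans (fire_ge_pred _ _ _).
by rewrite (negPf nab) subr0.
Qed.

(** A letter is fired legally only from a count of at least 1, so no legal step creates a negative
    count. *)
Lemma legal_lb c w a m : legal c w -> m <= 0 -> m <= c.1 a -> m <= (wfire w c).1 a.
Proof.
elim: w c => //= b w IH c /andP[hb hw] m0 mc; apply: IH => //.
apply: le_trans (fire_ge_pred _ _ _); have [->|_] := eqVneq a b; last by rewrite subr0.
by apply: le_trans m0 _; rewrite subr_ge0.
Qed.

Lemma legal_fired_ge0 c w a : legal c w -> a \in w -> 0 <= (wfire w c).1 a.
Proof.
elim: w c => //= b w IH c /andP[hb hw]; rewrite inE => /orP[/eqP e|]; last exact: IH.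
apply: legal_lb => //; apply: le_trans (fire_ge_pred _ _ _).
by rewrite e eqxx subr_ge0.
Qed.

(* Least action principle: a letter fired more often by w than by v would be      *)
(* fired while its count is already nonpositive.                                  *)
Lemma least_action c w v : legal c w -> (forall a, (wfire v c).1 a <= 0) ->
  (forall a, (count_mem a w <= count_mem a v)%N).
Proof.
elim: w v c => //= a w IH v c /andP[ha hw] hv b.
have av : a \in v.
  apply/negPn/negP => /(wfire_notin_ge c) h.
  by have := le_trans (le_trans ha h) (hv a).
have h := IH (rem a v) (fire a c) hw; rewrite wfire_rem // in h.
by have := h hv b; have /permP -> := perm_to_rem av; rewrite /=; lia.
Qed.

Lemma nonhalting_long c n : ~ halts c -> exists w, legal c w /\ size w = n.
Proof.
move=> hc; elim: n => [|n [w [lw sw]]]; first by exists [::].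
have [/forallP h|] := boolP [forall a, (wfire w c).1 a <= 0].
  by case: hc; exists (wfire w c) => //; exists w.
rewrite negb_forall => /existsP[a]; rewrite -ltNge => ha.
exists (rcons w a); rewrite size_rcons sw; split=> //.
by rewrite -cats1 legal_cat lw /= andbT.
Qed.

(** By least action no legal execution is longer than [v], whereas a nonhalting configuration has
    legal executions of every length. *)
Lemma halts_of_wfire c v : (forall a, (wfire v c).1 a <= 0) -> halts c.
Proof.
move=> hv; apply: contrapT => /(@nonhalting_long _ (size v).+1)[w [lw sw]].
have [u /perm_size] := sub_word (least_action lw hv).
by rewrite size_cat sw addSn => e; move: (leq_addr (size u) (size v)); rewrite -ltnS e ltnn.
Qed.

Definition wpow j w : seq (letter N) := flatten (nseq j w).

Lemma wpowS j w : wpow j.+1 w = w ++ wpow j w.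
Proof. by []. Qed.

Lemma count_wpow j w a : count_mem a (wpow j w) = (j * count_mem a w)%N.
Proof. by elim: j => //= j IH; rewrite count_cat IH mulSn. Qed.

Lemma wstep_wpow j w q : wstep (wpow j w) q = iter j (wstep w) q.
Proof. by elim: j q => //= j IH q; rewrite wstep_cat IH -iterS iterSr. Qed.

Lemma wpow_dominates w v : (forall a, a \in w) -> exists j,
  forall a, (count_mem a v <= count_mem a (wpow j w))%N.
Proof.
move=> hw; exists (size v) => a; rewrite count_wpow.
apply: leq_trans (count_size _ _) _; rewrite leq_pmulr //.
by rewrite -has_count has_pred1.
Qed.

Lemma exec_wpow j w c : exec c w c -> exec c (wpow j w) c.
Proof.
move=> [lw ew]; elim: j => [|j [l e]]; first by split.
by split; rewrite wpowS ?legal_cat ?wfire_cat ?lw ?ew.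
Qed.

Lemma wcount_word_of (n : nvec N) : wcount (word_of n) = n.
Proof.
apply/ffunP => a; rewrite ffunE /word_of count_flatten -map_comp.
rewrite sumnE big_map big_enum /= (bigD1 a) //= count_nseq /= eqxx mul1n big1 ?addn0 //.
by move=> b nb; rewrite count_nseq /= (negPf nb).
Qed.

Lemma perm_word_of w : perm_eq (word_of (wcount w)) w.
Proof. by apply/wcount_perm; rewrite wcount_word_of. Qed.

Lemma legally_related_wfire c v :
  (exists u, legal c u /\ forall a, (count_mem a v <= count_mem a u)%N) ->
  legally_related c (wfire v c).
Proof.
move=> [u [lu hu]]; apply/asboolP; exists (wfire u c); first by exists u.
exact: legal_remove.
Qed.

End Words.

(** * Locally recurrent states *)

Lemma pigeonhole (T : finType) (f : nat -> T) :
  exists i j, [/\ (i < j)%N, (j <= #|T|)%N & f i = f j].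
Proof.
have [/injectiveP/leq_card|/injectivePn[i [j nij e]]] :=
  boolP (injectiveb (fun i : 'I_#|T|.+1 => f i)).
  by rewrite card_ord ltnn.
have [ij|ij|/val_inj ij] := ltngtP i j.
- by exists i, j; split=> //; rewrite -ltnS.
- by exists j, i; split=> //; rewrite -ltnS.
- by rewrite ij eqxx in nij.
Qed.

Section LocallyRecurrent.
Variable N : finNetwork.
Implicit Types (u v w : seq (letter N)) (q : gstate N).

Local Notation Loc := (@locally_recurrent N).
Local Notation e := (loc_idempotent N).

Lemma wstepC w w' q : wstep w (wstep w' q) = wstep w' (wstep w q).
Proof. by rewrite -!wstep_cat; apply: wstep_perm; rewrite perm_catC. Qed.

Lemma transition_monoidP (f : {ffun gstate N -> gstate N}) :
  reflect (exists w, forall q, f q = wstep w q) (f \in transition_monoid N).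
Proof.
rewrite inE; apply: (iffP (asboolP _)) => -[w h]; exists w.
  by move=> q; rewrite h ffunE.
by apply/ffunP => q; rewrite ffunE.
Qed.

Lemma big_end_comp_mem (r : seq {ffun gstate N -> gstate N}) (P : pred _) :
  (forall f, P f -> f \in transition_monoid N) ->
  \big[@end_comp N/[ffun q => q]]_(f <- r | P f) f \in transition_monoid N.
Proof.
move=> h; apply: (big_rec (fun f => f \in transition_monoid N)) => [|f g].
  by apply/transition_monoidP; exists [::] => q; rewrite ffunE.
move=> /h/transition_monoidP[w hw] /transition_monoidP[w' hw'].
by apply/transition_monoidP; exists (w' ++ w) => q; rewrite ffunE hw hw' wstep_cat.
Qed.

Lemma loc_idempotent_word : exists w, forall q, e q = wstep w q.
Proof. by apply/transition_monoidP; apply: big_end_comp_mem => f /andP[]. Qed.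

(** [f] is a factor of the product defining the idempotent; commutativity moves it past the factors
    before its own occurrence, where f f = f absorbs it. *)
Lemma loc_idempotent_absorb f q :
  f \in transition_monoid N -> end_comp f f = f -> f (e q) = e q.
Proof.
move=> fM ff; have comm w : forall g : {ffun gstate N -> gstate N},
    g \in transition_monoid N -> forall p, g (wstep w p) = wstep w (g p).
  by move=> g /transition_monoidP[w' h] p; rewrite !h wstepC.
rewrite /loc_idempotent.
have : f \in index_enum {ffun gstate N -> gstate N} by rewrite mem_index_enum.
elim: (index_enum _) => //= g r IH; rewrite inE big_cons => /orP[/eqP <-|/IH{}IH].
  by rewrite fM ff eqxx /= ffunE -[in LHS](ffunE (fun q => f (f q))) -/(end_comp f f) ff.
case: ifP => // /andP[gM gg]; rewrite !ffunE.
by have /transition_monoidP[w hw] := gM; rewrite hw (comm w) // IH.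
Qed.

Lemma loc_idempotentK q : e (e q) = e q.
Proof.
rewrite [X in fun_of_fin X (e q)]/loc_idempotent.
elim: (index_enum _) => [|g r IH]; first by rewrite big_nil ffunE.
rewrite big_cons; case: ifP => // /andP[gM /eqP gg].
by rewrite ffunE IH loc_idempotent_absorb.
Qed.

Lemma locP q : Loc q <-> e q = q.
Proof.
split=> [[p _ <-]|h]; first exact: loc_idempotentK.
by exists q.
Qed.

Lemma loc_wstep w q : Loc q -> Loc (wstep w q).
Proof.
move=> /locP h; apply/locP; have [w0 hw0] := loc_idempotent_word.
by rewrite hw0 wstepC -hw0 h.
Qed.

Lemma idempotent_power w : exists2 j, (0 < j)%N &
  forall q, wstep (wpow j w) (wstep (wpow j w) q) = wstep (wpow j w) q.
Proof.
have [i [j [ij _ eij]]] := pigeonhole (fun j => [ffun q => wstep (wpow j w) q]).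
have {eij} h q : iter i (wstep w) q = iter j (wstep w) q.
  by move/ffunP/(_ q): eij; rewrite !ffunE !wstep_wpow.
set p := (j - i)%N; have hp k m q : (i <= m)%N ->
    iter (m + k * p) (wstep w) q = iter m (wstep w) q.
  move=> im; elim: k => [|k IH]; first by rewrite addn0.
  have -> : (m + k.+1 * p)%N = ((m + k * p - i) + j)%N by rewrite /p; nia.
  rewrite iterD -h -iterD; have -> : (m + k * p - i + i)%N = (m + k * p)%N by nia.
  exact: IH.
(* A positive multiple of the period that is at least the preperiod [i], so doubling this exponent
   changes nothing. *)
exists (i.+1 * p)%N; first by rewrite muln_gt0 /p subn_gt0 ij.
move=> q; rewrite !wstep_wpow -iterD; apply: hp; rewrite /p; nia.
Qed.

(** An idempotent power of [w] fixes q; that power with one copy of [w] removed undoes [w]. *)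
Lemma loc_inv q w : Loc q -> exists w', wstep w' (wstep w q) = q.
Proof.
move=> /locP h; have [[|j] // _ hj] := idempotent_power w.
have := @loc_idempotent_absorb [ffun q => wstep (wpow j.+1 w) q] q.
rewrite h ffunE => hh; exists (wpow j w); rewrite -wstep_cat -wpowS; apply: hh.
  by apply/transition_monoidP; exists (wpow j.+1 w) => p; rewrite ffunE.
by apply/ffunP => p; rewrite !ffunE hj.
Qed.

(** [w0] is a word acting as the idempotent, so any word containing its letters sends every state
    into the image. *)
Lemma loc_dominated : exists w0, forall w,
  (forall a, (count_mem a w0 <= count_mem a w)%N) -> forall q, Loc (wstep w q).
Proof.
have [w0 hw0] := loc_idempotent_word; exists w0 => w /sub_word[u hu] q.
by rewrite -(wstep_perm _ hu) wstep_cat; apply/loc_wstep/locP; rewrite -hw0 loc_idempotentK.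
Qed.

Lemma loc_nonempty : exists q, Loc q.
Proof.
have h (s : vertex N) : exists x : state s, true.
  by have /card_gt0P[x _] := state_nonempty s; exists x.
have [w0 hw0] := loc_dominated; pose q : gstate N := finfun (fun s => xchoose (h s)).
by exists (wstep w0 q); exact: hw0.
Qed.

Hypothesis hirr : locally_irreducible N.

Lemma loc_trans q q' : Loc q -> Loc q' -> exists w, wstep w q = q'.
Proof.
move=> _ hq'; have [w [w' h]] := hirr q q'; have [u hu] := loc_inv w' hq'.
by exists (w ++ u); rewrite wstep_cat h.
Qed.

Lemma loc_fix w q q' : Loc q -> Loc q' -> wstep w q = q -> wstep w q' = q'.
Proof.
by move=> hq hq' h; have [u <-] := loc_trans hq hq'; rewrite wstepC h.
Qed.

End LocallyRecurrent.

(** * Production matrix and exchange rate *)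

Section Production.
Variable N : finNetwork.
Implicit Types (a b : letter N) (u v w : seq (letter N)) (q : gstate N).

Local Notation Loc := (@locally_recurrent N).
Local Notation P := (mxentry (production_matrix N)).

(** These are the words with letter count in the total kernel K, see [total_kernelE]. *)
Definition closed_word w : Prop := forall q, Loc q -> wstep w q = q.

Lemma closed_word_perm w w' : perm_eq w w' -> closed_word w -> closed_word w'.
Proof. by move=> h hw q /hw; rewrite (wstep_perm _ h). Qed.

Lemma closed_word_flatten (ws : seq (seq (letter N))) :
  (forall w, w \in ws -> closed_word w) -> closed_word (flatten ws).
Proof.
elim: ws => [|w ws IH] h q hq //=; rewrite wstep_cat (h w) ?mem_head // IH // => v hv.
by apply: h; rewrite inE hv orbT.
Qed.

Lemma closed_word_wpow j w : closed_word w -> closed_word (wpow j w).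
Proof. by move=> h; apply: closed_word_flatten => v /nseqP[->]. Qed.

Lemma wmsg_flatten (ws : seq (seq (letter N))) q :
  (forall w, w \in ws -> closed_word w) -> Loc q ->
  wmsg (flatten ws) q = \sum_(w <- ws) wmsg w q.
Proof.
elim: ws => [|w ws IH] h hq; first by rewrite big_nil.
rewrite big_cons /= wmsg_cat (h w) ?mem_head // IH // => v hv.
by apply: h; rewrite inE hv orbT.
Qed.

Lemma wmsg_wpow j w q : closed_word w -> Loc q -> wmsg (wpow j w) q = wmsg w q *+ j.
Proof.
move=> h hq; rewrite wmsg_flatten // => [|v /nseqP[->] //].
by rewrite big_nseq iter_addr_0.
Qed.

Lemma ffun_mulrn (n : nvec N) j a : (n *+ j) a = (n a * j)%N.
Proof.
elim: j => [|j IH]; first by rewrite mulr0n ffunE muln0.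
by rewrite mulrS ffunE IH mulnS.
Qed.

Lemma total_kernelE (k : nvec N) :
  total_kernel (nvec_to_zvec k) <-> closed_word (word_of k).
Proof.
have -> : total_kernel (nvec_to_zvec k) <->
    (forall q, Loc q -> nstep k q = nstep 0 q).
  have pk : pos_part (nvec_to_zvec k) = k.
    by apply/ffunP => a; rewrite !ffunE; lia.
  have nk : neg_part (nvec_to_zvec k) = 0.
    by apply/ffunP => a; rewrite !ffunE; lia.
  by rewrite /total_kernel /= pk nk.
have w0 q : nstep (0 : nvec N) q = q.
  rewrite /nstep; rewrite (@wstep_perm _ _ [::]) //; apply/wcount_perm.
  by rewrite wcount_word_of; apply/ffunP => a; rewrite !ffunE.
by split=> h q hq; have := h q hq; rewrite w0.
Qed.

Hypothesis hirr : locally_irreducible N.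

Lemma closed_wordP w q : Loc q -> wstep w q = q -> closed_word w.
Proof. by move=> hq h q' hq'; exact: (loc_fix hirr hq). Qed.

(** With [u] leading from q to q', the words w u and u w send the same messages from q; the messages
    of [u] cancel. *)
Lemma wmsg_closed_eq w q q' : closed_word w -> Loc q -> Loc q' -> wmsg w q = wmsg w q'.
Proof.
move=> h hq hq'; have [u hu] := loc_trans hirr hq hq'.
have := wmsg_perm q (permEl (perm_catC w u)); rewrite !wmsg_cat hu h // => /ffunP e.
by apply/ffunP => a; have := e a; rewrite !ffunE [X in _ = X -> _]addrC => /addIn.
Qed.

Lemma closed_word_power w : exists2 d, (0 < d)%N & closed_word (wpow d w).
Proof.
have [d d0 hd] := idempotent_power w; exists d => // q hq.
by apply: (closed_wordP (loc_wstep (wpow d w) hq)); rewrite // hd.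
Qed.

Lemma closed_letter_power : exists2 d, (0 < d)%N & forall a, closed_word (nseq d a).
Proof.
have [f hf] : exists f : letter N -> nat, forall a, (0 < f a)%N /\ closed_word (nseq (f a) a).
  apply: (@fin_all_exists _ (fun=> nat) (fun a d => (0 < d)%N /\ closed_word (nseq d a))).
  move=> a; have [d d0 hd] := closed_word_power [:: a]; exists d; split=> //.
  apply: closed_word_perm hd; apply/allP => b _ /=.
  by rewrite count_wpow /= addn0 count_nseq /= mulnC.
exists (\prod_a f a)%N; first by rewrite prodn_gt0 // => a; have [] := hf a.
move=> a; have [_ ha] := hf a; rewrite (bigD1 a) //=; set m := (X in (_ * X)%N).
apply: closed_word_perm (closed_word_wpow m ha); apply/allP => b _ /=.
by rewrite count_wpow !count_nseq /=; apply/eqP; ring.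
Qed.

(** Column b is the message count of b^d divided by d, where every b^d is closed. The d-th power of
    a closed word rearranges into blocks b^d, and message counts add over closed words. *)
Lemma production_matrix_exists : exists P, @is_production_matrix N P.
Proof.
have [d d0 hd] := closed_letter_power; have [q0 hq0] := loc_nonempty N.
exists (\matrix_(i, j) ((wmsg (nseq d (enum_val j)) q0 (enum_val i))%:R / d%:R)).
move=> k q /total_kernelE hk hq a; rewrite /nmsg.
have dn0 : d%:R != 0 :> rat by rewrite pnatr_eq0 -lt0n.
apply: (mulIf dn0); rewrite -natrM -ffun_mulrn -wmsg_wpow //.
rewrite (wmsg_closed_eq _ hq hq0); last exact: closed_word_wpow.
pose ws := [seq wpow (k b) (nseq d b) | b <- enum (letter N)].
have hws v : v \in ws -> closed_word v.
  by move=> /mapP[b _ ->]; exact: closed_word_wpow.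
have pw : perm_eq (wpow d (word_of k)) (flatten ws).
  apply/allP => b _ /=; rewrite count_wpow count_flatten -map_comp sumnE big_map big_enum /=.
  rewrite (bigD1 b) //= count_wpow count_nseq /= eqxx mul1n big1 => [|c nc]; last first.
    by rewrite count_wpow count_nseq /= (negPf nc) mul0n muln0.
  have /ffunP/(_ b) := wcount_word_of k; rewrite ffunE => ->.
  by rewrite addn0 mulnC.
rewrite (wmsg_perm _ pw) wmsg_flatten // big_map big_enum /= mulr_suml.
rewrite sum_ffunE natr_sum; apply: eq_bigr => b _.
rewrite wmsg_wpow // ffun_mulrn /mxentry mxE !enum_rankK natrM.
by field.
Qed.

Lemma production_matrixE w q a : closed_word w -> Loc q ->
  \sum_b P a b * (count_mem b w)%:R = (wmsg w q a)%:R.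
Proof.
move=> hw hq; have pw := perm_word_of w.
have := xgetPex 0 production_matrix_exists => /(_ (wcount w) q).
rewrite total_kernelE /nmsg (wmsg_perm _ pw) => h; rewrite -h //.
  by apply: eq_bigr => b _; rewrite ffunE.
by apply: closed_word_perm hw; rewrite perm_sym.
Qed.

Lemma production_matrix_ge0 a b : 0 <= P a b.
Proof.
have [d d0 hd] := closed_letter_power; have [q0 hq0] := loc_nonempty N.
have := production_matrixE a (hd b) hq0; rewrite (bigD1 b) //= big1 => [|c nc]; last first.
  by rewrite count_nseq /= eq_sym (negPf nc) mul0n mulr0.
rewrite addr0 count_nseq /= eqxx mul1n => h.
by have := ler0n rat (wmsg (nseq d b) q0 a); rewrite -h pmulr_lge0 // ltr0n.
Qed.

Hypothesis hconn : strongly_connected N.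

Lemma strongly_connected_ind (X : pred (letter N)) :
  (forall a b, X a -> 0 < P b a -> X b) -> forall a b, X a -> X b.
Proof.
move=> h a b; have /connectP[p] := hconn a b.
elim: p a => [|c p IH] a /=; first by move=> _ ->.
by case/andP=> hc hp hb Xa; apply: IH hp hb _; exact: h hc.
Qed.

Lemma production_matrix_irr i j : exists k, 0 < (production_matrix N ^+ k) i j.
Proof.
have P0 k l m : 0 <= (production_matrix N ^+ k) l m.
  elim: k l m => [|k IH] l m; first by rewrite expr0 mxE; case: eqP.
  rewrite exprS mxE sumr_ge0 // => r _; rewrite mulr_ge0 //.
  by have := production_matrix_ge0 (enum_val l) (enum_val r); rewrite /mxentry !enum_valK.
pose X b := `[< exists k, 0 < (production_matrix N ^+ k) (enum_rank b) j >].
suff /asboolP : X (enum_val i) by rewrite enum_valK.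
apply: (@strongly_connected_ind X _ (enum_val j)) => [a b /asboolP[k hk] hab|].
  apply/asboolP; exists k.+1; rewrite exprS mxE (bigD1 (enum_rank a)) //=.
  apply: ltr_wpDr; last exact: mulr_gt0.
  apply: sumr_ge0 => r _; rewrite mulr_ge0 //.
  by have := production_matrix_ge0 b (enum_val r); rewrite /mxentry !enum_valK.
by apply/asboolP; exists 0%N; rewrite enum_valK expr0 mxE eqxx.
Qed.

(** * The exchange rate and the conserved weight *)

Hypothesis hcrit : critical N.

(** The spectral radius is attained by an eigenvalue, which the empty matrix does not have. *)
Lemma card_letter_gt0 : (0 < #|letter N|)%N.
Proof.
have [[z /eigenvalueP[v _ v0] _] _] := hcrit.
rewrite lt0n; apply: contra v0 => /eqP h; apply/eqP/rowP => m.
by have := ltn_ord m; rewrite [X in (_ < X)%N]h.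
Qed.

Lemma common_denominator (I : finType) (s : I -> rat) : (forall i, 0 < s i) ->
  exists2 D : nat, (0 < D)%N &
    exists2 t : I -> nat, forall i, (0 < t i)%N & forall i, s i * D%:R = (t i)%:R.
Proof.
move=> s0; exists (\prod_i `|denq (s i)|)%N.
  by rewrite prodn_gt0 // => i; rewrite absz_gt0 denq_neq0.
exists (fun i => `|numq (s i)| * \prod_(j | j != i) `|denq (s j)|)%N => i.
  rewrite muln_gt0 absz_gt0 numq_eq0 gt_eqF ?s0 //= prodn_gt0 // => j.
  by rewrite absz_gt0 denq_neq0.
rewrite (bigD1 i) //= !natrM mulrA; congr (_ * _).
rewrite !natr_absz [in LHS]ger0_norm ?denq_ge0 // ger0_norm ?numqE //.
by rewrite numq_ge0 ltW.
Qed.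

Lemma biggcdn_div (I : finType) (t : I -> nat) (i0 : I) : (0 < t i0)%N ->
  \big[gcdn/0%N]_i (t i %/ \big[gcdn/0%N]_j t j)%N = 1%N.
Proof.
set g := \big[gcdn/0%N]_j t j => t0.
have gt i : (g %| t i)%N by rewrite /g (biggcdn_inf i).
have g0 : (0 < g)%N by apply: dvdn_gt0 (gt i0).
apply/eqP; rewrite -(eqn_pmul2l g0) muln1; apply/eqP.
rewrite (big_morph (muln g) (muln_gcdr g) (muln0 g)) [in RHS]/g.
by apply: eq_bigr => i _; rewrite mulnC divnK.
Qed.

(** Clear the denominators of the positive left eigenvector from [perron_left] and divide by the gcd
    of its entries. *)
Lemma exchange_rate_exists : exists s, @is_exchange_rate N s.
Proof.
have Pge0 i j : 0 <= production_matrix N i j.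
  by have := production_matrix_ge0 (enum_val i) (enum_val j); rewrite /mxentry !enum_valK.
have [s [s0 sP]] := perron_left Pge0 production_matrix_irr hcrit.
have [D D0 [t t0 st]] := common_denominator (fun a : letter N => s0 (enum_rank a)).
have [a0 _] := card_gt0P card_letter_gt0.
pose g := \big[gcdn/0%N]_a t a.
have gt a : (g %| t a)%N by rewrite /g (biggcdn_inf a).
have g0 : (0 < g)%N by apply: dvdn_gt0 (gt a0).
exists [ffun a => (t a %/ g)%N%:Z]; split=> [a|b|].
- by rewrite ffunE ltz_nat divn_gt0 // dvdn_leq.
- have tg a : s 0 (enum_rank a) * D%:R = ((t a %/ g)%N%:Z)%:~R * g%:R :> rat.
    by rewrite st -[in LHS](divnK (gt a)) natrM.
  have gn0 : g%:R != 0 :> rat by rewrite pnatr_eq0 -lt0n.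
  apply: (mulIf gn0); rewrite ffunE -tg -[in RHS]sP mxE !mulr_suml.
  rewrite (reindex_onto enum_rank enum_val) /= => [|i _]; last by rewrite enum_valK.
  rewrite [RHS](eq_bigl xpredT) => [|a]; last by rewrite enum_rankK eqxx.
  apply: eq_bigr => a _; rewrite ffunE mulrAC -tg /mxentry; ring.
- rewrite -[RHS](biggcdn_div (t0 a0)); apply: eq_bigr => a _.
  by rewrite ffunE.
Qed.

Local Notation s := (exchange_rate N).

Definition wt (y : zvec N) : int := \sum_a s a * y a.

Lemma exchange_rateP : is_exchange_rate s.
Proof. exact: xgetPex exchange_rate_exists. Qed.

Lemma wtD (y z : zvec N) : wt (y + z) = wt y + wt z.
Proof.
by rewrite /wt -big_split; apply: eq_bigr => a _; rewrite ffunE mulrDr.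
Qed.

Lemma wtN (y : zvec N) : wt (- y) = - wt y.
Proof.
by rewrite /wt -sumrN; apply: eq_bigr => a _; rewrite ffunE mulrN.
Qed.

Lemma wtB (y z : zvec N) : wt (y - z) = wt y - wt z.
Proof. by rewrite wtD wtN. Qed.

Lemma wt0 : wt 0 = 0.
Proof. by rewrite /wt big1 // => a _; rewrite ffunE mulr0. Qed.

Lemma wtMn (y : zvec N) j : wt (y *+ j) = wt y *+ j.
Proof. by elim: j => [|j IH]; rewrite ?mulr0n ?wt0 // !mulrS wtD IH. Qed.

Lemma wt_le0 (y : zvec N) : (forall a, y a <= 0) -> wt y <= 0.
Proof.
move=> h; rewrite /wt -oppr_ge0 -sumrN; apply: sumr_ge0 => a _.
by rewrite -mulrN mulr_ge0 ?oppr_ge0 // ltW //; have [h' _ _] := exchange_rateP.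
Qed.

Lemma wt_ge0 (y : zvec N) : (forall a, 0 <= y a) -> 0 <= wt y.
Proof.
move=> h; apply: sumr_ge0 => a _.
by rewrite mulr_ge0 // ltW //; have [h' _ _] := exchange_rateP.
Qed.

(** The entries of the exchange rate have gcd 1, so iterated Bezout gives a vector of weight 1. *)
Lemma wt_surj m : exists y, wt y = m.
Proof.
suff [y hy] : exists y, wt y = 1.
  exists [ffun a => y a * m]; rewrite -[RHS]mul1r -hy /wt mulr_suml.
  by apply: eq_bigr => a _; rewrite ffunE mulrA.
have [_ _ h] := exchange_rateP.
suff [y hy] : exists y, wt y = (\big[gcdn/0%N]_a `|s a|%N)%:Z by exists y; rewrite hy h.
apply: (big_rec (fun n : nat => exists y, wt y = n%:Z)) => [|a n _ [y hy]].
  by exists 0; rewrite wt0.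
have [u [v huv]] := Bezoutz (s a) n.
exists [ffun b => (b == a)%:R * u + y b * v].
transitivity (u * s a + v * wt y); last first.
  by rewrite hy huv /gcdz; case: (s a).
rewrite /wt mulr_sumr; under eq_bigr => b _ do rewrite ffunE mulrDr.
rewrite big_split /= (bigD1 a) //= eqxx mul1r big1 => [|b nb]; last first.
  by rewrite (negPf nb) mul0r mulr0.
by rewrite addr0 mulrC; congr (_ + _); apply: eq_bigr => b _; ring.
Qed.

(** On closed words messages are given by P, and s^T P = s^T. *)
Lemma wt_closed w q : closed_word w -> Loc q ->
  wt (nvec_to_zvec (wmsg w q)) = wt (nvec_to_zvec (wcount w)).
Proof.
move=> hw hq; apply: (@intr_inj rat); rewrite /wt !rmorph_sum /=.
transitivity (\sum_b (\sum_a (s a)%:~R * P a b) * (count_mem b w)%:R).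
  under [RHS]eq_bigr => b _ do rewrite mulr_suml.
  rewrite exchange_big; apply: eq_bigr => a _; rewrite !ffunE rmorphM /=.
  rewrite -[X in _ * X]/((wmsg w q a)%:R) -(production_matrixE a hw hq) mulr_sumr.
  by apply: eq_bigr => b _; rewrite mulrA.
apply: eq_bigr => b _; rewrite !ffunE rmorphM /=.
by have [_ -> _] := exchange_rateP.
Qed.

(** The letter count k satisfies P k = k with k >= 0, so its support is closed under the edges of
    the production digraph. *)
Lemma closed_word_full w q : closed_word w -> Loc q -> wmsg w q = wcount w ->
  w != [::] -> forall a, a \in w.
Proof.
move=> hw hq hm wn a; have [b hb] : exists b, b \in w.
  by case: w wn {hw hm} => // b w _; exists b; rewrite mem_head.
apply: (@strongly_connected_ind (mem w) _ b a hb) => {hb}{}b c hb hbc.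
rewrite inE -has_pred1 has_count -(ltr_nat rat).
have := production_matrixE c hw hq; rewrite hm ffunE => <-.
rewrite (bigD1 b) //=; apply: ltr_wpDr.
  by apply: sumr_ge0 => r _; rewrite mulr_ge0 ?production_matrix_ge0.
by rewrite mulr_gt0 // ltr0n -has_count has_pred1.
Qed.

End Production.

(** * Heights, cycles and capacity *)

(** The maximum is b - n for the least natural n with b - n in A; being the unique supremum, it is
    what [supremum] returns. *)
Lemma supremum_int_max (A : set int) (b : int) : A !=set0 -> (forall x, A x -> x <= b) ->
  A (supremum 0 A) /\ forall x, A x -> x <= supremum 0 A.
Proof.
move=> [x0 Ax0] hb.
have hex : exists n : nat, `[< A (b - n%:Z) >].
  exists `|b - x0|%N; apply/asboolP; rewrite gez0_abs ?subr_ge0 ?hb //.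
  by rewrite opprB addrC subrK.
case: (ex_minnP hex) => n /asboolP An nmin.
have ubn x : A x -> x <= b - n%:Z.
  move=> Ax; have hx := hb x Ax; have /nmin : `[< A (b - `|b - x|%N%:Z) >].
    apply/asboolP; rewrite gez0_abs ?subr_ge0 //.
    by rewrite opprB addrC subrK.
  lia.
have sup_n : supremums A (b - n%:Z) by split=> // y; exact.
have -> : supremum 0 A = b - n%:Z.
  rewrite /supremum; case: ifPn => [/eqP A0|_]; first by rewrite A0 in Ax0.
  by apply: (is_subset1_supremums (A := A)) => //; apply: xgetPex; exists (b - n%:Z).
by [].
Qed.

Section Dynamics.
Variable N : finNetwork.
Implicit Types (a b : letter N) (u v w : seq (letter N)) (q : gstate N) (c d : config N).
Implicit Types (y z : zvec N).

Local Notation Loc := (@locally_recurrent N).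

Hypothesis hirr : locally_irreducible N.
Hypothesis hconn : strongly_connected N.
Hypothesis hcrit : critical N.

Lemma wfire_closed w c : closed_word w -> Loc c.2 -> wt (wfire w c).1 = wt c.1.
Proof.
move=> hw hc; rewrite wfireE wtD wtB.
by rewrite (wt_closed hirr hconn hcrit hw hc) subrr addr0.
Qed.

Lemma wt_wfire_shift w c d : c.2 = d.2 -> wt (wfire w c).1 - wt c.1 = wt (wfire w d).1 - wt d.1.
Proof. by move=> e; rewrite !wfireE /addz /= !wtD e; ring. Qed.

(** One word [x] completes both [v] and [v'] to closed words, which preserve the weight, and [x]
    changes the weight equally after either. *)
Lemma wt_wfire_eq v v' c : Loc c.2 -> wstep v c.2 = wstep v' c.2 ->
  wt (wfire v c).1 = wt (wfire v' c).1.
Proof.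
move=> hc e; have [x hx] := loc_inv v hc.
have cl : closed_word (v ++ x) by apply: (closed_wordP hirr hc); rewrite wstep_cat hx.
have cl' : closed_word (v' ++ x) by apply: (closed_wordP hirr hc); rewrite wstep_cat -e hx.
have := wfire_closed cl' hc; rewrite -(wfire_closed cl hc) !wfire_cat.
have := @wt_wfire_shift x (wfire v c) (wfire v' c); rewrite !wfireE /= => /(_ e).
lia.
Qed.

Definition base_state : gstate N := projT1 (cid (loc_nonempty N)).

Lemma loc_base_state : Loc base_state.
Proof. exact: projT2 (cid (loc_nonempty N)). Qed.

(** For locally recurrent q such a word exists by [loc_trans], so the value is not the default. *)
Definition homing q : seq (letter N) := xget [::] [set u | wstep u q = base_state].

Lemma homingP q : Loc q -> wstep (homing q) q = base_state.
Proof.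
move=> hq; apply: (@xgetPex _ [::] [set u | wstep u q = base_state]).
exact: loc_trans loc_base_state.
Qed.

(* On locally recurrent states this is the level, up to an additive constant.     *)
Definition height c : int := wt (wfire (homing c.2) c).1.

Definition height_bound : int :=
  \sum_q `|wt (nvec_to_zvec (wmsg (homing q) q) - nvec_to_zvec (wcount (homing q)))|.

Lemma height_wfire w c : Loc c.2 -> height (wfire w c) = height c.
Proof.
move=> hc; have hw : (wfire w c).2 = wstep w c.2 by rewrite wfireE.
rewrite /height -wfire_cat; apply: wt_wfire_eq => //.
by rewrite wstep_cat -hw !homingP // hw; exact: loc_wstep.
Qed.

Lemma height_addz y c : height (addz y c) = height c + wt y.
Proof. by rewrite /height wfire_addz wtD. Qed.

Lemma height_bounds c : `|height c - wt c.1| <= height_bound.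
Proof.
rewrite /height wfireE wtD /= addrC addKr /height_bound (bigD1 c.2) //= lerDl.
by apply: sumr_ge0.
Qed.

(** Height is invariant under firing, and at the final configuration the weight is nonpositive. *)
Lemma halts_height c : Loc c.2 -> halts c -> height c <= height_bound.
Proof.
move=> hc [d [w [_ <-]] /(wt_le0 hirr hconn hcrit)].
by have := height_bounds (wfire w c); rewrite height_wfire //; lia.
Qed.

(** * Cycles and liveness of nonhalting configurations *)

Definition config_bounded (K : nat) c : Prop := forall a, `|c.1 a| <= K%:Z.

Lemma bounded_pigeonhole K : exists n, forall f : nat -> config N,
  (forall i, (i <= n)%N -> config_bounded K (f i)) ->
  exists i j, [/\ (i < j)%N, (j <= n)%N & f i = f j].
Proof.
pose T : finType := ({ffun letter N -> 'I_(K + K).+1} * gstate N)%type.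
have aux (x x' : int) : `|x| <= K%:Z -> `|x'| <= K%:Z ->
    inord `|x + K%:Z| = inord `|x' + K%:Z| :> 'I_(K + K).+1 -> x = x'.
  by move=> hx hx' /(congr1 val) /=; rewrite !inordK; lia.
exists #|T| => f hf.
have [i [j [ij jn [/ffunP e e2]]]] := pigeonhole
  (fun i => ([ffun a => inord `|(f i).1 a + K%:Z|], (f i).2) : T).
exists i, j; split=> //; rewrite [LHS]surjective_pairing [RHS]surjective_pairing e2.
congr pair; apply/ffunP => a.
have hi := hf i (ltnW (leq_trans ij jn)) a; have hj := hf j jn a.
by have := e a; rewrite !ffunE ; exact: aux.
Qed.

(** After translation by L all coordinates are nonnegative and the weights are at least 1, so each
    coordinate is at most the total weight. *)
Lemma bounded_of_wt_le (L : nat) (U : int) : exists K, forall c,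
  (forall a, - L%:Z <= c.1 a) -> wt c.1 <= U -> config_bounded K c.
Proof.
pose t : zvec N := [ffun=> L%:Z]; exists (L + `|(U + wt t)%R|)%N => c hL hU a.
have [s0 _ _] := exchange_rateP hirr hconn hcrit.
have h0 b : 0 <= (c.1 + t) b by rewrite !ffunE -lerBlDr sub0r.
have : (c.1 + t) a <= wt (c.1 + t).
  rewrite /wt (bigD1 a) //=; apply: ler_wpDr.
    by apply: sumr_ge0 => b _; rewrite mulr_ge0 // ltW.
  by rewrite ler_peMl // -gtz0_ge1.
have aux (x m k : int) : - L%:Z <= x -> m <= U -> x + L%:Z <= m + k ->
    `|x| <= (L + `|(U + k)%R|)%N%:Z by lia.
by rewrite wtD !ffunE; apply: aux.
Qed.

(** Along a legal execution the counts are bounded below by legality, and the weight is bounded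
    above because the height is conserved. A long enough execution must repeat a configuration. *)
Lemma nonhalting_cycle c : Loc c.2 -> ~ halts c -> exists d w,
  [/\ reach c d, exec d w d & w != [::]].
Proof.
move=> hc hh; pose L := (\sum_a `|c.1 a|)%N.
have [K hK] := bounded_of_wt_le L (height c + height_bound).
have [n hn] := bounded_pigeonhole K.
have [w [lw sw]] := nonhalting_long n hh.
have lt i : legal c (take i w) by move: lw; rewrite -{1}(cat_take_drop i w) legal_cat => /andP[].
have [i [j [ij jn e]]] : exists i j, [/\ (i < j)%N, (j <= n)%N &
    wfire (take i w) c = wfire (take j w) c].
  apply: hn => i _; apply: hK => [a|].
    have hL : `|c.1 a|%N%:Z <= L%:Z by rewrite lez_nat /L (bigD1 a) //= leq_addr.
    by apply: legal_lb => //; lia.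
  have := height_bounds (wfire (take i w) c); rewrite height_wfire //; lia.
have tE : take j w = take i w ++ drop i (take j w).
  by rewrite -[LHS](cat_take_drop i) take_takel // ltnW.
exists (wfire (take i w) c), (drop i (take j w)); split.
- by exists (take i w).
- by move: (lt j); rewrite {1}tE legal_cat => /andP[_ ?]; split=> //; rewrite -wfire_cat -tE.
- by rewrite -size_eq0 size_drop size_takel ?sw // subn_eq0 -ltnNge.
Qed.

Lemma nvec_to_zvec_inj : injective (@nvec_to_zvec N).
Proof.
by move=> n m /ffunP e; apply/ffunP => a; have := e a; rewrite !ffunE; case.
Qed.

Lemma wfire_fixP w c : wfire w c = c <-> wstep w c.2 = c.2 /\ wmsg w c.2 = wcount w.
Proof.
rewrite wfireE; split=> [h|[h ->]]; last by rewrite subrr addz0 h -surjective_pairing.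
have [h1 h2] : (c.1 + (nvec_to_zvec (wmsg w c.2) - nvec_to_zvec (wcount w)) = c.1)
   * (wstep w c.2 = c.2).
  by case: c h => x q [].
split=> //; apply: nvec_to_zvec_inj; apply/eqP; rewrite -subr_eq0; apply/eqP.
by apply: (addrI c.1); rewrite addr0.
Qed.

(** Since firings commute, the cycle persists after firing [w0], where the state is locally
    recurrent and [closed_word_full] applies. *)
Lemma cycle_full w c : wfire w c = c -> w != [::] -> forall a, a \in w.
Proof.
move=> e wn; have [w0 hw0] := loc_dominated N; have hl : Loc (wstep w0 c.2) by exact: hw0.
have : wfire w (wfire w0 c) = wfire w0 c.
  by rewrite -wfire_cat (wfire_perm _ (permEl (perm_catC _ _))) wfire_cat e.
rewrite wfire_fixP [wfire w0 c]wfireE /= => -[h1 h2].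
exact: (closed_word_full hirr hconn (closed_wordP hirr hl h1) hl h2).
Qed.

Lemma wfire_wpow_fix j w c : wfire w c = c -> wfire (wpow j w) c = c.
Proof. by move=> e; elim: j => //= j IH; rewrite wfire_cat e. Qed.

Lemma cycle_loc w c : wfire w c = c -> w != [::] -> Loc c.2.
Proof.
move=> e wn; have [w0 hw0] := loc_dominated N.
have [j hj] := wpow_dominates w0 (cycle_full e wn).
have /wfire_fixP[<- _] := wfire_wpow_fix j e; exact: hw0.
Qed.

(** The condition under which [legal_remove] can absorb an arbitrary word fired from c. *)
Definition live c : Prop :=
  forall v, exists u, legal c u /\ forall a, (count_mem a v <= count_mem a u)%N.

Lemma cycle_live w c : exec c w c -> w != [::] -> live c.
Proof.
move=> h wn v; have [j hj] := wpow_dominates v (cycle_full h.2 wn).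
by exists (wpow j w); split=> //; have [] := exec_wpow j h.
Qed.

Lemma reach_live c d : reach c d -> live d -> live c.
Proof.
move=> [w [lw <-]] hd v; have [u [lu hu]] := hd v; exists (w ++ u).
split=> [|a]; first by rewrite legal_cat lw.
by rewrite count_cat; apply: leq_trans (hu a) (leq_addl _ _).
Qed.

Lemma nonhalting_live c : Loc c.2 -> ~ halts c -> live c.
Proof.
move=> hc hh; have [d [w [r h wn]]] := nonhalting_cycle hc hh.
exact: reach_live r (cycle_live h wn).
Qed.

(** If c reaches x by [v], then removing [v] from a high enough power of the cycle leads from x back
    to c. *)
Lemma cycle_recurrent w c : exec c w c -> w != [::] -> recurrent_config c.
Proof.
move=> h wn; split; first by exists w => //; case: h.
move=> d /asboolP[x rd [v [_ ev]]]; apply: reach_trans rd _; rewrite -ev.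
have [j hj] := wpow_dominates v (cycle_full h.2 wn); have [lj ej] := exec_wpow j h.
by rewrite -[X in reach _ X]ej; exact: legal_remove.
Qed.

Lemma recurrent_cycle c : recurrent_config c -> exists2 w, w != [::] & exec c w c.
Proof.
move=> [[w wn lw] hc]; have [|w' [lw' e]] := hc (wfire w c).
  by apply/asboolP; exists (wfire w c); [exact: reach_refl | exists w].
exists (w ++ w'); first by case: w wn {lw lw' e}.
by split; rewrite ?legal_cat ?lw ?wfire_cat.
Qed.

Lemma exists_height q m : exists x, height (x, q) = m.
Proof.
have [y hy] := wt_surj hirr hconn hcrit (m - height (0, q)); exists y.
have -> : (y, q) = addz y (0, q) by rewrite /addz /= add0r.
by rewrite height_addz hy; lia.
Qed.

(** A configuration above [height_bound] yields one cycle; its word is closed and its messages do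
    not depend on the locally recurrent state, so it fixes all these configurations. *)
Lemma period_word : exists2 k : seq (letter N), forall a, a \in k &
  forall c, Loc c.2 -> wfire k c = c.
Proof.
have [x hx] := exists_height base_state (height_bound + 1).
have [|d [w [[v [_ ed]] [_ ew] wn]]] := @nonhalting_cycle (x, base_state) loc_base_state.
  by move=> /(@halts_height (x, base_state) loc_base_state); rewrite hx; lia.
exists w; first exact: cycle_full ew wn.
have ld := cycle_loc ew wn; have /wfire_fixP[h1 h2] := ew.
have cl := closed_wordP hirr ld h1.
move=> c hc; apply/wfire_fixP; split; first exact: cl.
by rewrite (wmsg_closed_eq hirr cl hc ld).
Qed.

(** The inverse is what remains of a power of the period word after deleting [w]. *)
Lemma wfire_inv w c : Loc c.2 -> exists w', wfire w' (wfire w c) = c.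
Proof.
move=> hc; have [k kf hk] := period_word; have [j hj] := wpow_dominates w kf.
have [u hu] := sub_word hj; exists u.
by rewrite -wfire_cat (wfire_perm _ hu) wfire_wpow_fix // hk.
Qed.

Lemma wfire_loc w c : Loc c.2 -> Loc (wfire w c).2.
Proof. by rewrite wfireE; exact: loc_wstep. Qed.

(** * Capacity, and the level as a shifted height *)

Lemma halts_wfire w c : halts (wfire w c) -> halts c.
Proof.
by move=> [d [v [_ <-]] h]; apply: (@halts_of_wfire _ _ (w ++ v)); rewrite wfire_cat.
Qed.

(** Halting passes back along illegal firings, and [wfire_inv] makes this symmetric. *)
Lemma cap_set_wfire w c : Loc c.2 ->
  [set wt z | z in [set z | halts (z + (wfire w c).1, (wfire w c).2)]] =
  [set wt z | z in [set z | halts (z + c.1, c.2)]].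
Proof.
move=> hc; congr image; apply/seteqP.
have addE z d : (z + d.1, d.2) = addz z d by rewrite /addz addrC.
split=> z /=; rewrite !addE -wfire_addz; first exact: halts_wfire.
have [w' hw'] := @wfire_inv w (addz z c) hc.
by rewrite -{1}hw'; exact: halts_wfire.
Qed.

Lemma cap_wfire w c : Loc c.2 -> cap (wfire w c) = cap c.
Proof. by move=> hc; rewrite /cap (cap_set_wfire w hc). Qed.

Lemma cap_max c : Loc c.2 ->
  (exists2 z, halts (z + c.1, c.2) & wt z = cap c) /\
  forall z, halts (z + c.1, c.2) -> wt z <= cap c.
Proof.
move=> hc; have [||[z hz hz'] h2] := @supremum_int_max
    [set wt z | z in [set z | halts (z + c.1, c.2)]] (height_bound - height c).
- exists (wt (- c.1)), (- c.1) => //=; exists (- c.1 + c.1, c.2); first exact: reach_refl.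
  by move=> a; rewrite addNr ffunE.
- move=> _ [z /= hz <-]; have := @halts_height (_, _) hc hz.
  have -> : (z + c.1, c.2) = addz z c by rewrite /addz addrC.
  by rewrite height_addz; lia.
split; first by exists z.
by move=> z' hz2; apply: h2; exists z'.
Qed.

Lemma cap_addz y c : Loc c.2 -> cap (addz y c) = cap c - wt y.
Proof.
move=> hc; have [[z hz <-] zm] := cap_max hc.
have [[z' hz' <-] zm'] := @cap_max (addz y c) hc.
apply/eqP; rewrite eq_le; apply/andP; split.
  by rewrite lerBrDr -wtD; apply: zm; move: hz'; rewrite /addz /= (addrC c.1) addrA.
by rewrite -wtB; apply: zm'; rewrite /addz /= (addrC c.1) addrA subrK.
Qed.

Definition level_shift : int := network_cap N - cap (0, base_state).

(** Homing does not change the capacity and leads to a translate of (0, [base_state]) by a vector of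
    weight [height c]. *)
Lemma level_height c : Loc c.2 -> level c = level_shift + height c.
Proof.
move=> hc; rewrite /level /level_shift -(cap_wfire (homing c.2) hc) /height.
have -> : wfire (homing c.2) c = addz (wfire (homing c.2) c).1 (0, base_state).
  by rewrite /addz /= add0r -(homingP hc) wfireE.
by rewrite cap_addz; [rewrite /= add0r; lia | exact: loc_base_state].
Qed.

End Dynamics.

(** * Walks *)

Lemma infinite_uniq_seq (T : eqType) (A : set T) m : infinite_set A ->
  exists s : seq T, [/\ uniq s, size s = m & forall i, i \in s -> A i].
Proof.
move=> hA; elim: m => [|m [s [us ss sA]]]; first by exists [::].
have [x Ax xs] : exists2 x, A x & x \notin s.
  apply: contrapT => h; apply: hA; apply: (sub_finite_set (B := [set` s])); last exact: finite_seq.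
  by move=> x Ax /=; apply/negPn/negP => xs; apply: h; exists x.
exists (x :: s); split; rewrite /= ?xs ?us ?ss // => i.
by rewrite inE => /orP[/eqP ->|/sA].
Qed.

Section Walks.
Variable N : finNetwork.
Implicit Types (a b : letter N) (u v w : seq (letter N)) (c d : config N).
Local Notation comp := (@Defs.comp N).
Implicit Types (I : set int) (x : int -> config N) (l : int -> letter N).

Lemma walk_index_convex I i j k : walk_index I -> I i -> I k -> i <= j -> j <= k -> I j.
Proof. by case=> -> //= hi hk hij hjk; lia. Qed.

(** The letter [l i] labels the step from i - 1 to i, hence the shift by 1 in the word. *)
Lemma walk_segment I x l i n : is_walk I x l -> (forall k, (k <= n)%N -> I (i + k%:Z)) ->
  exec (x i) (mkseq (fun k => l (i + k%:Z + 1)) n) (x (i + n%:Z)).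
Proof.
move=> hw; elim: n => [|n IH] hI; first by split=> //; rewrite addr0.
have [|l1 e1] := IH; first by move=> k kn; apply: hI; exact: leqW.
have e : i + n.+1%:Z - 1 = i + n%:Z by lia.
have := hw (i + n.+1%:Z); rewrite e => /(_ (hI n (leqnSn n)) (hI n.+1 (leqnn _)))[l2 e2].
have e' : i + n%:Z + 1 = i + n.+1%:Z by lia.
rewrite /mkseq -addn1 iotaD map_cat /= add0n e' -/(mkseq _ _).
by split; rewrite ?legal_cat ?wfire_cat ?l1 e1 ?addn1.
Qed.

Lemma index_span I (S : seq int) i0 : I i0 -> (forall i, i \in S -> I (i - 1) /\ I i) ->
  exists lo hi, [/\ I lo, I hi, lo <= hi & forall i, i \in S -> lo <= i - 1 /\ i <= hi].
Proof.
move=> hi0; elim: S => [|i S IH] hS; first by exists i0, i0.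
have [|lo [hi [hlo hhi le h]]] := IH; first by move=> j jS; apply: hS; rewrite inE jS orbT.
have [hi1 hi2] := hS i (mem_head _ _).
exists (Num.min lo (i - 1)), (Num.max hi i); split.
- by case: leP.
- by case: leP.
- lia.
- by move=> j; rewrite inE => /orP[/eqP ->|/h]; lia.
Qed.

(** Choose [size v] occurrences of every letter; since the index set is convex, a finite segment of
    the walk spans them all. *)
Lemma diverse_walk_dominates I x l v : walk_index I -> is_walk I x l -> diverse I l ->
  (0 < #|letter N|)%N -> exists i j u, [/\ I j, exec (x i) u (x j) &
    forall a, (count_mem a v <= count_mem a u)%N].
Proof.
move=> hI hw hd /card_gt0P[a0 _].
have [s hs] : exists s : letter N -> seq int, forall a, [/\ uniq (s a), size (s a) = size v &
    forall i, i \in s a -> [/\ I (i - 1), I i & l i = a]].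
  apply: (@fin_all_exists _ (fun=> seq int) (fun a s => [/\ uniq s, size s = size v &
    forall i, i \in s -> [/\ I (i - 1), I i & l i = a]])) => a.
  by have [s [us ss hs]] := infinite_uniq_seq (size v) (hd a); exists s.
have [[|i0 t] [_ // _ ht]] := infinite_uniq_seq 1 (hd a0).
have [_ Ii0 _] := ht i0 (mem_head _ _).
have [|lo [hi [hlo hhi lohi h]]] := index_span (S := flatten [seq s a | a <- enum (letter N)]) Ii0.
  by move=> i /flatten_mapP[a _ ia]; have [_ _ /(_ i ia)[]] := hs a.
pose n := `|hi - lo|%N; have nE : hi = lo + n%:Z by rewrite /n; lia.
exists lo, hi, (mkseq (fun k => l (lo + k%:Z + 1)) n); split=> // [|a].
  rewrite nE; apply: (walk_segment hw) => k kn.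
  by apply: (walk_index_convex hI hlo hhi); lia.
have [us ss hsa] := hs a; apply: leq_trans (count_size _ _) _; rewrite -ss.
rewrite /mkseq count_map -size_filter -(size_map (fun i : int => `|(i - lo - 1)%R|%N)).
have hb i : i \in s a -> lo <= i - 1 /\ i <= hi.
  by move=> ia; apply: h; apply/flatten_mapP; exists a; rewrite ?mem_enum.
apply: uniq_leq_size => [|k /mapP[i ia ->]].
  rewrite map_inj_in_uniq // => i j /hb hi' /hb hj'; lia.
have [_ _ li] := hsa i ia; have hbi := hb i ia.
rewrite mem_filter mem_iota /=; apply/andP; split; last by rewrite /n; lia.
by apply/eqP; rewrite -[RHS]li; congr l; lia.
Qed.

Lemma cycle_recurrent_component w c : exec c w c -> (forall a, a \in w) ->
  (0 < #|letter N|)%N -> recurrent_component (comp c).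
Proof.
move=> [lw ew] hw /card_gt0P[a0 _].
pose n := size w; have n0 : (0 < n)%N.
  by apply: leq_trans (count_size (pred1 a0) w); rewrite -has_count has_pred1.
pose x (i : int) := wfire (take (`|i| %% n)%N w) c.
pose l (i : int) := nth a0 w (`|(i - 1)%R| %% n)%N.
have lt k : legal c (take k w).
  by move: lw; rewrite -{1}(cat_take_drop k w) legal_cat => /andP[].
exists [set i | 0 <= i], x, l; split; first by constructor 2.
- move=> i /= hi1 hi; rewrite /x /l; set k := (`|(i - 1)%R| %% n)%N.
  have kn : (k < n)%N by rewrite ltn_mod.
  have -> : wfire (take (`|i| %% n)%N w) c = wfire (take k.+1 w) c.
    have -> : (`|i| %% n = k.+1 %% n)%N.
      have -> : `|i|%N = (`|(i - 1)%R|%N + 1)%N by lia.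
      by rewrite /k -[in RHS]addn1 modnDml.
    have [kn'|] := ltnP k.+1 n; first by rewrite modn_small.
    rewrite leq_eqVlt ltnNge kn orbF => /eqP e.
    by rewrite -e modnn take0 /= {1}/n take_size ew.
  have := lt k.+1; rewrite (take_nth a0) // -cats1 legal_cat wfire_cat => /andP[_ ?].
  by split.
- move=> a /finite_seqP[t ht].
  (* The j-th pass through the cycle fires [a] at this index; the final 1 is there because [l i]
     labels the step ending at i. *)
  pose f j : int := (j * n + index a w + 1)%N.
  have fi : injective f by move=> j j' []; nia.
  have : (size (map f (iota 0 (size t).+1)) <= size t)%N.
    apply: uniq_leq_size; first by rewrite map_inj_uniq ?iota_uniq.
    move=> i /mapP[j _ ->]; have : [set` t] (f j); last by [].
    rewrite -ht /=; split; rewrite /f; [lia|lia|].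
    rewrite /l; have -> : `|((j * n + index a w + 1)%N%:Z - 1)%R|%N = (j * n + index a w)%N by lia.
    by rewrite modnMDl modn_small ?index_mem ?hw // nth_index.
  by rewrite size_map size_iota ltnn.
- move=> i _; apply/compP/asboolP; exists (x i); first exact: reach_refl.
  by exists (take (`|i| %% n)%N w).
Qed.

End Walks.

(** * Recurrent components and the torsion group *)

Section Components.
Variable N : finNetwork.
Implicit Types (a b : letter N) (u v w : seq (letter N)) (c d : config N).
Implicit Types (y z : zvec N) (n m : nvec N) (C : rec_component N).

Local Notation Loc := (@locally_recurrent N).
Local Notation comp := (@Defs.comp N).
Local Notation toZ := (@nvec_to_zvec N).

Hypothesis hirr : locally_irreducible N.
Hypothesis hconn : strongly_connected N.
Hypothesis hcrit : critical N.

Definition moves c d : Prop := exists w, wfire w c = d.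

Lemma moves_trans d c1 c2 : moves c1 d -> moves d c2 -> moves c1 c2.
Proof. by move=> [w <-] [w' <-]; exists (w ++ w'); rewrite wfire_cat. Qed.

Lemma moves_sym c d : Loc c.2 -> moves c d -> moves d c.
Proof. by move=> hc [w <-]; exact: wfire_inv. Qed.

Lemma moves_addz y c d : moves c d -> moves (addz y c) (addz y d).
Proof. by move=> [w <-]; exists w; rewrite wfire_addz. Qed.

Lemma moves_loc c d : Loc c.2 -> moves c d -> Loc d.2.
Proof. by move=> hc [w <-]; exact: wfire_loc. Qed.

Lemma moves_height c d : Loc c.2 -> moves c d -> height d = height c.
Proof. by move=> hc [w <-]; exact: height_wfire. Qed.

Lemma reach_moves c d : reach c d -> moves c d.
Proof. by move=> [w [_ <-]]; exists w. Qed.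

Lemma comp_moves c d : Loc c.2 -> Loc d.2 -> comp c = comp d -> moves c d.
Proof.
move=> hc hd /compP/asboolP[x /reach_moves cx /reach_moves dx].
exact: moves_trans cx (moves_sym hd dx).
Qed.

Lemma reach_comp c d : reach c d -> comp c = comp d.
Proof. by move=> r; apply/compP/asboolP; exists d => //; exact: reach_refl. Qed.

Definition high c : Prop := Loc c.2 /\ height_bound N < height c.

Lemma high_nonhalting c : high c -> ~ halts c.
Proof. by move=> [hc h] /(halts_height hirr hconn hcrit hc); rewrite leNgt h. Qed.

(** High configurations do not halt, so they are live and absorb the illegal word: here orbits and
    components coincide. *)
Lemma high_comp c d : high c -> moves c d -> comp c = comp d.
Proof.
move=> h [w <-]; apply/compP/legally_related_wfire.
exact: (nonhalting_live hirr hconn hcrit h.1 (high_nonhalting h)).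
Qed.

Lemma high_cycle c : high c -> exists d w, [/\ comp c = comp d, Loc d.2, height d = height c,
  exec d w d & w != [::]].
Proof.
move=> h; have [hc _] := h.
have [d [w [r e wn]]] := nonhalting_cycle hirr hconn hcrit hc (high_nonhalting h).
exists d, w; split=> //; first exact: reach_comp.
  exact: moves_loc hc (reach_moves r).
exact: moves_height hc (reach_moves r).
Qed.

Lemma high_recurrent c : high c -> recurrent_component (comp c).
Proof.
move=> h; have [d [w [-> _ _ e wn]]] := high_cycle h.
exact: cycle_recurrent_component e (cycle_full hirr hconn e.2 wn) (card_letter_gt0 hcrit).
Qed.

Definition high_rec c (h : high c) : rec_component N :=
  exist _ (comp c) (introT (asboolP _) (high_recurrent h)).

(** A segment of a diverse walk containing [w0] ends in a locally recurrent state, and every letter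
    fired along it ends with a nonnegative count. *)
Lemma rec_componentP C : exists c, [/\ val C = comp c, Loc c.2 & forall a, 0 <= c.1 a].
Proof.
case: C => C /= /asboolP[I [x [l [hI hw hd hC]]]].
have [w0 hw0] := loc_dominated N.
have [i [j [u [Ij [lu eu] hu]]]] :=
  diverse_walk_dominates (w0 ++ enum (letter N)) hI hw hd (card_letter_gt0 hcrit).
exists (x j); rewrite hC // -eu; split=> // [|a].
  rewrite wfireE; apply: hw0 => a; apply: leq_trans (hu a).
  by rewrite count_cat leq_addr.
apply: legal_fired_ge0 => //; rewrite -has_pred1 has_count; apply: leq_trans (hu a).
rewrite count_cat; apply: leq_trans (leq_addl _ _).
by rewrite -has_count has_pred1 mem_enum.
Qed.

(* The subgroup (P - I)K of Z^A, described without the production matrix.         *)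
Definition lattice y : Prop := forall c, Loc c.2 -> moves c (addz y c).

(** One configuration suffices: any other is a translate of some firing of c, and firing is
    invertible and commutes with translation. *)
Lemma latticeI y c : Loc c.2 -> moves c (addz y c) -> lattice y.
Proof.
move=> hc h d hd; have [w hw] := loc_trans hirr hc hd.
have e : d = addz (d.1 - (wfire w c).1) (wfire w c).
  rewrite /addz /= addrC subrK; case: d hd hw => x q _ /= <-.
  by rewrite [wfire w c]wfireE.
move: (d.1 - _) e => t ->; rewrite -addzD [y + t]addrC addzD; apply: moves_addz.
have cw : moves c (wfire w c) by exists w.
apply: moves_trans (moves_sym hc cw) _; apply: moves_trans h _.
by rewrite -wfire_addz; exists w.
Qed.

Lemma lattice_wt y : lattice y -> wt y = 0.
Proof.
move=> hy; have h := hy (0, base_state N) (loc_base_state N).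
have := @moves_height (_, _) _ (loc_base_state N) h; rewrite height_addz.
by move/(congr1 (fun t => t - height (0, base_state N))); rewrite addrAC subrr add0r.
Qed.

Lemma shift_recE n C c : val C = comp c -> val (shift_rec n C) = comp (addc n c).
Proof. by move=> e; rewrite /= e shift_comp. Qed.

Lemma exists_high (B : int) : exists c, high c /\ B <= height c.
Proof.
have [x hx] := exists_height hirr hconn hcrit (base_state N) (`|height_bound N| + 1 + `|B|).
exists (x, base_state N); split; last by rewrite hx; lia.
by split; [exact: loc_base_state | rewrite hx; lia].
Qed.

Lemma exists_high_shift : exists k, forall n c,
  Loc c.2 -> (forall a, 0 <= c.1 a) -> high (addc (n + k) c).
Proof.
(* One [height_bound] pays for the gap between height and weight, the other for the threshold in
   [high]. *)
pose K : nat := (2 * `|height_bound N| + 1)%N; exists [ffun=> K] => n c hc c0; split=> //.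
have [a0 _] := card_gt0P (card_letter_gt0 hcrit).
have [s0 _ _] := exchange_rateP hirr hconn hcrit.
have wn : 0 <= wt (toZ n) by apply: wt_ge0 => // a; rewrite ffunE.
have wc : 0 <= wt c.1 by apply: wt_ge0.
have wk : K%:Z <= wt (toZ [ffun=> K]).
  rewrite /wt (bigD1 a0) //= !ffunE; apply: ler_wpDr.
    by apply: sumr_ge0 => b _; rewrite !ffunE mulr_ge0 // ltW.
  by rewrite ler_peMl // -gtz0_ge1.
have hb := height_bounds c.
rewrite addcE height_addz nvec_to_zvecD wtD.
rewrite /K in wk *; lia.
Qed.

(** This identifies the Grothendieck group with Z^A modulo the lattice. One direction evaluates the
    equal shifts at a high component; the other adds a shift making all recurrent components high,
    where lattice vectors act trivially. *)
Lemma groth_phiP n n' m m' :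
  groth_class (phi n) (phi n') = groth_class (phi m) (phi m') <->
  lattice (toZ n - toZ n' - (toZ m - toZ m')).
Proof.
set y := (X in lattice X).
have ey k : toZ (n + m' + k) = y + toZ (m + n' + k).
  by rewrite !nvec_to_zvecD /y; apply/ffunP => a; rewrite !ffunE; ring.
rewrite groth_classP; split=> [[k0]|hy].
  have [k ->] := phi_surj k0; rewrite -!phiD => /(congr1 (fun f => shift_fun f)) e.
  have [c [h _]] := exists_high 0.
  have := congr1 (fun f => val (f (high_rec h))) e.
  rewrite /= !shift_comp => /comp_moves mv.
  have mh : moves (addc (m + n' + k) c) (addc (n + m' + k) c).
    by apply: moves_sym (mv _ _); case: h.
  by move: mh; rewrite !addcE ey addzD; apply: latticeI; case: h.
have [k0 hk0] := exists_high_shift; exists (phi k0); rewrite -!phiD; apply: val_inj.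
apply/funext => C; apply: val_inj; have [c [eC hc c0]] := rec_componentP C.
rewrite /= eC !shift_comp; apply/esym/high_comp; first exact: hk0.
by rewrite !addcE ey addzD; apply: hy.
Qed.

(** * Torsion classes and their action on high components *)

Lemma phi_mulrn n (d : nat) : phi (n *+ d) = phi n *+ d.
Proof. by elim: d => [|d IH]; rewrite ?mulr0n ?mulrS ?phi0 // phiD IH. Qed.

Lemma groth_class_mulrn (f g : shift_monoid N) (d : nat) :
  groth_class f g *+ d = groth_class (f *+ d) (g *+ d).
Proof. by elim: d => [|d IH] //; rewrite !mulrS IH; exact: groth_add_class. Qed.

Lemma groth_phi_torsion n n' (d : nat) :
  groth_class (phi n) (phi n') *+ d = 0 <-> lattice ((toZ n - toZ n') *+ d).
Proof.
rewrite groth_class_mulrn -!phi_mulrn.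
have -> : (0 : groth (shift_monoid N)) = groth_class (phi 0) (phi 0) by [].
by rewrite groth_phiP !nvec_to_zvecMn subrr subr0 -mulrnBl.
Qed.

(** A positive multiple of n - n' lies in the lattice, which has weight 0, and the integers are
    torsion free. *)
Lemma Tor_rep (g : Tor N) : exists n n', torsion_val g = groth_class (phi n) (phi n') /\
  wt (toZ n - toZ n') = 0.
Proof.
case: g => g /= /asboolP[d d0]; elim/groth_ind: g => f f'.
have [n ->] := phi_surj f; have [n' ->] := phi_surj f'.
move=> /groth_phi_torsion/lattice_wt; rewrite wtMn => h.
exists n, n'; split=> //; apply/eqP; move/eqP: h.
by rewrite mulrn_eq0 gtn_eqF.
Qed.

(** One representative of g determines C', by subtracting n' within the orbit; any other differs
    from it by a lattice vector, which does not change a high component. *)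
Lemma tor_imageP (g : Tor N) n n' C C' c : torsion_val g = groth_class (phi n) (phi n') ->
  high c -> val C = comp c ->
  tor_image g C C' <-> val C' = comp (addz (toZ n - toZ n') c).
Proof.
move=> eg hc eC.
have wt0 : wt (toZ n - toZ n') = 0.
  have [m [m' [eg' h]]] := Tor_rep g; move: eg'; rewrite eg => /groth_phiP/lattice_wt.
  by rewrite wtB h subr0.
have hd : high (addz (toZ n - toZ n') c).
  by case: hc => h1 h2; split=> //; rewrite height_addz wt0 addr0.
have low k x : high x -> high (addc k x).
  case=> h1 h2; split=> //; rewrite addcE height_addz; apply: lt_le_trans h2 _.
  by rewrite lerDl wt_ge0 // => a; rewrite ffunE.
split=> [h|eC' m m' eg'].
  have [d [eD hd' _]] := rec_componentP C'; rewrite eD.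
  have := congr1 val (h n n' eg); rewrite (shift_recE _ eC) (shift_recE _ eD).
  move=> /(@comp_moves (addc n c) (addc n' d) hc.1 hd')/(moves_addz (- toZ n')).
  rewrite !addcE -!addzD addNr addz0 [- _ + _]addrC => mv.
  by apply/esym/high_comp.
apply: val_inj; rewrite (shift_recE _ eC) (shift_recE _ eC').
apply: high_comp; first exact: low.
rewrite !addcE -addzD; move: eg; rewrite eg' => /esym/groth_phiP hl.
have -> : toZ m' + (toZ n - toZ n') = (toZ n - toZ n' - (toZ m - toZ m')) + toZ m.
  by apply/ffunP => a; rewrite !ffunE; ring.
by rewrite addzD; apply: hl; case: hc.
Qed.

Lemma tor_act_high (g : Tor N) n n' C c : torsion_val g = groth_class (phi n) (phi n') ->
  high c -> val C = comp c -> val (tor_act g C) = comp (addz (toZ n - toZ n') c).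
Proof.
move=> eg hc eC; apply/(tor_imageP _ eg hc eC).
rewrite /tor_act; apply: xgetPex.
have hd : high (addz (toZ n - toZ n') c).
  have [m [m' [eg' h]]] := Tor_rep g; move: eg'; rewrite eg => /groth_phiP/lattice_wt.
  rewrite wtB h subr0 => wt0; case: hc => h1 h2; split=> //.
  by rewrite height_addz wt0 addr0.
by exists (high_rec hd); apply/(tor_imageP _ eg hc eC).
Qed.

(** A recurrent configuration lies on a cycle, so its state is locally recurrent and its level is a
    shifted height. Conversely, a high component contains a cycle of the same height. *)
Lemma rec_levelP (m : int) C : height_bound N < m - level_shift N ->
  rec_level m C <-> exists c, [/\ Loc c.2, height c = m - level_shift N & val C = comp c].
Proof.
move=> hm; split=> [[c [rc eC lc]]|[c [hc hh eC]]].
  have [w wn [_ ew]] := recurrent_cycle rc; have hc := cycle_loc hirr hconn ew wn.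
  by exists c; split=> //; rewrite -lc level_height // addrC addKr.
have hgh : high c by split=> //; rewrite hh.
have [d [w [ed hd hhd e wn]]] := high_cycle hgh.
exists d; split; first by apply: (cycle_recurrent hirr hconn e wn).
  by rewrite eC ed.
by rewrite level_height // hhd hh addrC subrK.
Qed.

(* Every recurrent component of a given level contains one of the finitely many   *)
(* nonnegative configurations of that level.                                      *)
Lemma wt0_torsion y : wt y = 0 -> exists2 d : nat, (0 < d)%N & lattice (y *+ d).
Proof.
move=> wy; have [c [hc _]] := exists_high 0.
have high_y j : high (addz (y *+ j) c).
  by case: hc => h1 h2; split=> //; rewrite height_addz wtMn wy mul0rn addr0.
have h j : exists d, [/\ comp (addz (y *+ j) c) = comp d, Loc d.2 & forall a, 0 <= d.1 a].
  exact: (rec_componentP (high_rec (high_y j))).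
have [f hf] := choice h.
have [K hK] := bounded_of_wt_le hirr hconn hcrit 0 (height c + height_bound N).
have [n hn] := bounded_pigeonhole N K.
have [i [j [ij _ e]]] : exists i j, [/\ (i < j)%N, (j <= n)%N & f i = f j].
  apply: hn => j _; have [ej lj pj] := hf j; apply: hK => [a|]; first exact: pj.
  have [lc _] := high_y j; have := moves_height lc (comp_moves lc lj ej).
  by rewrite height_addz wtMn wy mul0rn addr0; have := height_bounds (f j); lia.
exists (j - i)%N; first by rewrite subn_gt0.
have [ei _ _] := hf i; have [ej _ _] := hf j.
(* The translates of c by i y and by j y share a component, so (j - i) y preserves an orbit. *)
have := comp_moves (high_y i).1 (high_y j).1; rewrite ei ej e => /(_ erefl).
rewrite -(subnK (ltnW ij)) mulrnDr addzD subnK ?(ltnW ij) //.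
exact: latticeI (high_y i).1.
Qed.

Lemma zvec_split y : exists n n', y = toZ n - toZ n'.
Proof.
exists (pos_part y), (neg_part y); apply/ffunP => a.
by rewrite !ffunE; lia.
Qed.

Lemma tor_regular (m : int) : height_bound N < m - level_shift N ->
  [/\ tor_act_defined N m, action_on (@tor_act N) (rec_level m),
      free_on (@tor_act N) (rec_level m) & transitive_on (@tor_act N) (rec_level m)].
Proof.
move=> hm.
have highP c : Loc c.2 -> height c = m - level_shift N -> high c by move=> hc e; split; rewrite ?e.
have shiftP y c : wt y = 0 -> height c = m - level_shift N ->
    height (addz y c) = m - level_shift N by move=> wy; rewrite height_addz wy addr0.
split.
- move=> C /(rec_levelP _ hm)[c [lc hc eC]]; have hg := highP c lc hc; split=> g.
    have [n [n' [eg wy]]] := Tor_rep g.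
    exists (high_rec (highP (addz (toZ n - toZ n') c) lc (shiftP _ _ wy hc))).
    by apply/(tor_imageP _ eg hg eC).
  have [n [n' [eg _]]] := Tor_rep g; move=> C1 C2.
  move=> /(tor_imageP _ eg hg eC) e1 /(tor_imageP _ eg hg eC) e2.
  by apply: val_inj; rewrite e1 e2.
- split=> [g C|C|g h C] /(rec_levelP _ hm)[c [lc hc eC]]; have hg := highP c lc hc.
  + have [n [n' [eg wy]]] := Tor_rep g; apply/(rec_levelP _ hm).
    exists (addz (toZ n - toZ n') c); split=> //; first exact: shiftP.
    exact: tor_act_high eg hg eC.
  + apply: val_inj; have e0 : torsion_val (0 : Tor N) = groth_class (phi 0) (phi 0) by [].
    by rewrite (tor_act_high e0 hg eC) subrr addz0.
  + have [n [n' [eg wy]]] := Tor_rep g; have [k [k' [eh wz]]] := Tor_rep h.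
    have egh : torsion_val (g + h) = groth_class (phi (n + k)) (phi (n' + k')).
      by rewrite !phiD -[RHS]groth_add_class -eg -eh.
    have eh' := tor_act_high eh hg eC.
    have hg' : high (addz (toZ k - toZ k') c) by apply: highP => //; exact: shiftP.
    apply: val_inj; rewrite (tor_act_high egh hg eC) (tor_act_high eg hg' eh') -addzD.
    by rewrite !nvec_to_zvecD; congr (comp (addz _ _)); apply/ffunP => a; rewrite !ffunE; ring.
(* Freeness: two translates of c in one component differ by a lattice vector, so the classes
   agree. *)
- move=> g g' C /(rec_levelP _ hm)[c [lc hc eC]] e; have hg := highP c lc hc.
  have [n [n' [eg wy]]] := Tor_rep g; have [k [k' [eh wz]]] := Tor_rep g'.
  have := congr1 val e; rewrite (tor_act_high eg hg eC) (tor_act_high eh hg eC).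
  move=> /esym/comp_moves mv; apply: val_inj; rewrite /= eg eh; apply/groth_phiP.
  apply: (@latticeI _ (addz (toZ k - toZ k') c)) => //.
  by rewrite -addzD subrK; apply: mv.
- split.
    have [x hx] := exists_height hirr hconn hcrit (base_state N) (m - level_shift N).
    exists (high_rec (highP (x, base_state N) (loc_base_state N) hx)).
    by apply/(rec_levelP _ hm); exists (x, base_state N); split=> //; exact: loc_base_state.
  move=> C C' /(rec_levelP _ hm)[c [lc hc eC]] /(rec_levelP _ hm)[c' [lc' hc' eC']].
  have [w hw] := loc_trans hirr lc lc'.
  have mw : moves c (wfire w c) by exists w.
  have lw := moves_loc lc mw; have hw' := moves_height lc mw; rewrite hc in hw'.
  (* Once the states agree, c' is a translate of the fired c by [y]; equal heights force weight 0,
     so [y] gives a torsion class. *)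
  pose y := c'.1 - (wfire w c).1.
  have ec' : c' = addz y (wfire w c).
    rewrite /addz /= addrC subrK; case: (c') hw => x q /= <-.
    by rewrite [wfire w c]wfireE.
  have wy : wt y = 0.
    by move: hc'; rewrite ec' height_addz hw' => h; lia.
  have [n [n' ey]] := zvec_split y; have [d d0 hd] := wt0_torsion wy.
  have tg : groth_class (phi n) (phi n') \in @is_torsion (groth (shift_monoid N)).
    by apply/asboolP; exists d => //; apply/groth_phi_torsion; rewrite -ey.
  exists (Torsion tg); apply: val_inj; rewrite eC'.
  rewrite (@tor_act_high (Torsion tg) n n' C (wfire w c)) //; first by rewrite -ey -ec'.
    exact: highP.
  by rewrite eC; apply: high_comp => //; exact: highP.
Qed.

End Components.

Theorem theorem1p2 (N : finNetwork) (hirr : locally_irreducible N)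
    (hconn : strongly_connected N) (hcrit : critical N) :
  finite_set [set m : nat | (0 < m)%N /\
    ~ [/\ tor_act_defined N m%:Z,
          action_on (@tor_act N) (rec_level m%:Z),
          free_on (@tor_act N) (rec_level m%:Z) &
          transitive_on (@tor_act N) (rec_level m%:Z)]].
Proof.
(* Beyond b, level m corresponds to a height above [height_bound], so all exceptions are at most
   b. *)
pose b := `|(level_shift N + height_bound N)%R|%N.
apply: (sub_finite_set (B := `I_b.+1)); last exact: finite_II.
move=> m [_ hm] /=; rewrite ltnS leqNgt; apply/negP => bm; apply: hm.
by apply: tor_regular => //; move: bm; rewrite /b; lia.
Qed.
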